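(* Let $q>0$, $q\neq 1$, and let $\mathcal{A}=\mathbb{C}\langle x,x^*\mid xx^*=qx^*x\rangle$. For $c\in\mathbb{R}$ set $L_c:=(x+x^* )^4-2(x+x^* )^2+c\in\mathcal{A}$. Then: (i) $L_c\in\sum\mathcal{A}^2$ if and only if $c\geq\dfrac{q(q+1)^2}{(q^2+1)^2}$; (ii) there exists $\varepsilon>0$ such that $(x+x^* )^4-2(x+x^* )^2+\dfrac{q(q+1)^2}{(q^2+1)^2}-\varepsilon\in\mathcal{A}_+$.
   Context: $\mathcal{A}$ is the unital complex $*$-algebra with single generator $x$ and defining relation $xx^*=qx^*x$; the set $\{x^{*m}x^n: m,n\in\mathbb{N}_0\}$ is a vector space basis of $\mathcal{A}$. $\sum\mathcal{A}^2$ denotes the set of finite sums $\sum_j a_j^*a_j$ with $a_j\in\mathcal{A}$. A densely defined operator $X$ on a Hilbert space is called $q$-normal if $\mathcal{D}(X)=\mathcal{D}(X^* )$ and $\|X^*f\|=\sqrt q\,\|Xf\|$ for all $f\in\mathcal{D}(X)$. Put $\mathcal{D}^\infty(X)=\bigcap_{n\ge1}\mathcal{D}(X^n)$. For $f=\sum_{m,n}\alpha_{mn}x^{*m}x^n\in\mathcal{A}$ write $f(X,X^* )=\sum_{m,n}\alpha_{mn}X^{*m}X^n$. An element $f=f^*\in\mathcal{A}$ belongs to $\mathcal{A}_+$ (is positive) if $\langle f(X,X^* )\varphi,\varphi\rangle\ge0$ for every $q$-normal operator $X$ and every $\varphi\in\mathcal{D}^\infty(X)$. *)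

(* Defs.v *)
From HB Require Import structures.
From mathcomp Require Import all_boot all_order all_algebra.
From mathcomp Require Import finmap sesquilinear.
From mathcomp Require Import boolp classical_sets reals topology normedtype.
From mathcomp Require Import complex.
(* Only the canonical structures of monalg are imported: its notations conflict with
   those of the analysis library. *)
From mathcomp Require monalg.

From mathcomp Require Import (canonicals) monalg.
Set Implicit Arguments.
Unset Strict Implicit.
Unset Printing Implicit Defensive.

Import Order.TTheory GRing.Theory Num.Theory numFieldNormedType.Exports.

Local Open Scope ring_scope.
Local Open Scope complex_scope.
Local Open Scope classical_set_scope.

(* The *-algebra C<x, x^* | x x^* = q x^* x>, realised on its monomial basis:
   the index (m, n) stands for x^*m x^n. The presentation is recovered by
   qx_rel and qalg_universal, the basis by qbasis_span and qbasis_free. *)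
Definition qalg (R : realType) (q : R) : Type :=
  monalg.malg (nat * nat)%type R[i].

HB.instance Definition _ (R : realType) (q : R) :=
  GRing.Lmodule.copy (qalg q) (monalg.malg (nat * nat)%type R[i]).

Section Additive.
Variables (V W : zmodType) (F : V -> W).
Hypothesis FB : {morph F : f g / f - g}.

Fact sub_0 : F 0 = 0.
Proof. by rewrite -[X in F X](subrr (0 : V)) FB subrr. Qed.

Fact sub_add : {morph F : f g / f + g}.
Proof. by move=> f g; rewrite -[g in LHS]opprK FB -[- g]sub0r FB sub_0 sub0r opprK. Qed.
End Additive.

Section QSum.
Context {R : realType} {q : R} {V : zmodType}.
Local Notation C := R[i].
Local Notation A := (qalg q).

Definition qcoef (f : A) (k : nat * nat) : C := monalg.mcoeff k f.
Definition qsupp (f : A) : {fset nat * nat} := monalg.msupp f.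
Definition qterm (c : C) (k : nat * nat) : A := monalg.mkmalgU k c.

(* The sum over (m, n) of F (m, n) alpha_mn, where f = sum alpha_mn x^*m x^n. *)
Definition qsum (F : nat * nat -> C -> V) (f : A) : V :=
  \sum_(k <- qsupp f) F k (qcoef f k).

Definition qadditive (F : nat * nat -> C -> V) :=
  forall k, {morph F k : c d / c - d}.

Lemma qadd0 F : qadditive F -> forall k, F k 0 = 0.
Proof. by move=> aF k; rewrite -[X in F k X](subrr 0) aF subrr. Qed.

Lemma qsumw F (D : {fset nat * nat}) f : qadditive F ->
  (qsupp f `<=` D)%fset -> qsum F f = \sum_(k <- D) F k (qcoef f k).
Proof.
move=> aF sD; rewrite /qsum; apply: big_fset_incl => // k _ kf.
by rewrite /qcoef monalg.mcoeff_outdom // qadd0.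
Qed.

Lemma qsum_additive F : qadditive F -> {morph qsum F : f g / f - g}.
Proof.
move=> aF f g; set D := (qsupp f `|` qsupp g)%fset.
rewrite (@qsumw F D (f - g)) //; last exact: monalg.msuppB_le.
rewrite (@qsumw F D f) ?fsubsetUl // (@qsumw F D g) ?fsubsetUr //.
rewrite -sumrB; apply: eq_bigr => k _.
by rewrite -aF /qcoef monalg.mcoeffB.
Qed.

Lemma qsumU F c k : qadditive F -> qsum F (qterm c k) = F k c.
Proof.
move=> aF; rewrite (@qsumw F [fset k]%fset) //; last exact: monalg.msuppU_le.
by rewrite big_seq_fset1 /qcoef monalg.mcoeffUU.
Qed.
End QSum.

Section QAlgebra.
Context {R : realType} {q : R}.
Local Notation C := R[i].
Local Notation A := (qalg q).
Implicit Types (f g h : A) (k l : nat * nat) (c d : C).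

Lemma qtermB k : {morph (@qterm R q)^~ k : c d / c - d}.
Proof. exact: (@monalg.monalgUB (nat * nat)%type C). Qed.

Lemma qterm_sum f : f = qsum (fun k c => qterm c k) f.
Proof. exact: (@monalg.monalgE (nat * nat)%type C). Qed.

Lemma qcoefZ c f k : qcoef (c *: f) k = c * qcoef f k.
Proof. exact: monalg.mcoeffZ. Qed.

Lemma qcoefU c k l : qcoef (qterm c k : A) l = c *+ (k == l).
Proof. exact: monalg.mcoeffU. Qed.

Lemma qcoefP f g : (forall k, qcoef f k = qcoef g k) -> f = g.
Proof. by move/(@monalg.malgP (nat * nat)%type C). Qed.

Lemma qtermZ c d k : c *: (qterm d k : A) = qterm (c * d) k.
Proof. by apply: qcoefP => l; rewrite qcoefZ !qcoefU mulrnAr. Qed.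

Lemma qalg_ext (V : zmodType) (F G : A -> V) :
  {morph F : f g / f - g} -> {morph G : f g / f - g} ->
  (forall c k, F (qterm c k) = G (qterm c k)) -> F =1 G.
Proof.
move=> aF aG FG.
move=> f; rewrite [f]qterm_sum /qsum.
rewrite (big_morph F (sub_add aF) (sub_0 aF)) (big_morph G (sub_add aG) (sub_0 aG)).
exact: eq_bigr.
Qed.

(* (x^*m x^n) (x^*m' x^n') = q^(n m') x^*(m + m') x^(n + n'). *)
Definition qmul f g : A :=
  qsum (fun k c => qsum (fun l d =>
    qterm (c * d * (q%:C) ^+ (k.2 * l.1)) (k.1 + l.1, k.2 + l.2)%N) g) f.

Definition qone : A := qterm 1 (0, 0)%N.

(* (alpha x^*m x^n)^* = conj(alpha) x^*n x^m. *)
Definition qstar f : A := qsum (fun k c => qterm (Num.conj c) (k.2, k.1)) f.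

Let in_add k c : qadditive (fun l d => qterm (c * d * (q%:C) ^+ (k.2 * l.1))
    (k.1 + l.1, k.2 + l.2)%N : A).
Proof. by move=> l d e; rewrite mulrBr mulrBl qtermB. Qed.

Let out_add g : qadditive (fun k c => qsum (fun l d =>
    qterm (c * d * (q%:C) ^+ (k.2 * l.1)) (k.1 + l.1, k.2 + l.2)%N : A) g).
Proof.
move=> k c d; rewrite /qsum -sumrB; apply: eq_bigr => l _.
by rewrite mulrBl mulrBl qtermB.
Qed.

Lemma qmulBl g : {morph qmul^~ g : f h / f - h}.
Proof. by move=> f h; apply: qsum_additive; exact: out_add. Qed.

Lemma qmulBr f : {morph qmul f : g h / g - h}.
Proof.
move=> g h; rewrite /qmul [LHS]/qsum [X in _ = X - _]/qsum.
rewrite [X in _ = _ - X]/qsum -sumrB; apply: eq_bigr => k _.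
by apply: qsum_additive; exact: in_add.
Qed.

Lemma qmulUU c k d l : qmul (qterm c k) (qterm d l) =
  qterm (c * d * (q%:C) ^+ (k.2 * l.1)) (k.1 + l.1, k.2 + l.2)%N.
Proof.
rewrite /qmul qsumU; last exact: out_add.
by rewrite qsumU //; exact: in_add.
Qed.

Lemma qmulA : associative qmul.
Proof.
move=> f g h; move: f; apply: qalg_ext => [f f'|f f'|c k]; rewrite ?qmulBl //.
move: g; apply: qalg_ext => [g g'|g g'|d l]; rewrite ?(qmulBl, qmulBr) //.
move: h; apply: qalg_ext => [h h'|h h'|e m]; rewrite ?(qmulBl, qmulBr) //.
rewrite !qmulUU /= !addnA mulnDr mulnDl !exprD; congr qterm.
rewrite -!mulrA; congr (c * (d * _)); rewrite [RHS]mulrCA; congr (e * _).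
by rewrite mulrC -mulrA.
Qed.

Lemma qmul1f : left_id qone qmul.
Proof.
apply: qalg_ext => [f g|f g|c [m n]]; rewrite ?qmulBr //.
by rewrite qmulUU /= mul1r mul0n expr0 mulr1 !add0n.
Qed.

Lemma qmulf1 : right_id qone qmul.
Proof.
apply: qalg_ext => [f g|f g|c [m n]]; rewrite ?qmulBl //.
by rewrite qmulUU /= mulr1 muln0 expr0 mulr1 !addn0.
Qed.

Lemma qmulDl : left_distributive qmul +%R.
Proof. by move=> f g h; rewrite (sub_add (qmulBl h)). Qed.

Lemma qmulDr : right_distributive qmul +%R.
Proof. by move=> f g h; rewrite (sub_add (qmulBr f)). Qed.

Lemma qone_neq0 : qone != 0.
Proof.
apply/eqP => /(congr1 (fun f : A => qcoef f (0, 0)%N)).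
rewrite qcoefU eqxx /qcoef monalg.mcoeff0 => /eqP; exact/negP/oner_neq0.
Qed.

Lemma qstarB : {morph qstar : f g / f - g}.
Proof. by apply: qsum_additive => k c d; rewrite rmorphB qtermB. Qed.

Lemma qstarU c k : qstar (qterm c k) = qterm (Num.conj c) (k.2, k.1).
Proof. by apply: qsumU => l d e; rewrite rmorphB qtermB. Qed.
End QAlgebra.

HB.instance Definition _ (R : realType) (q : R) :=
  GRing.Zmodule_isNzRing.Build (qalg q) (@qmulA R q) (@qmul1f R q)
    (@qmulf1 R q) (@qmulDl R q) (@qmulDr R q) (@qone_neq0 R q).

Section QAlgebraTheory.
Context {R : realType} {q : R}.
Local Notation C := R[i].
Local Notation A := (qalg q).
Implicit Types (f g h : A) (k l : nat * nat) (c d : C).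

Lemma qtermM c k d l : qterm c k * qterm d l =
  qterm (c * d * (q%:C) ^+ (k.2 * l.1)) (k.1 + l.1, k.2 + l.2)%N :> A.
Proof. exact: qmulUU. Qed.

Lemma qscalerAl c f g : c *: (f * g) = (c *: f) * g.
Proof.
move: f; apply: qalg_ext => [f f'|f f'|d k]; rewrite ?(mulrBl, scalerBr) //.
move: g; apply: qalg_ext => [g g'|g g'|e l]; rewrite ?(mulrBr, scalerBr) //.
by rewrite qtermZ !qtermM qtermZ !mulrA.
Qed.

HB.instance Definition _ := GRing.Lmodule_isLalgebra.Build C A qscalerAl.

Lemma qscalerAr c f g : c *: (f * g) = f * (c *: g).
Proof.
move: f; apply: qalg_ext => [f f'|f f'|d k]; rewrite ?(mulrBl, scalerBr) //.
move: g; apply: qalg_ext => [g g'|g g'|e l]; rewrite ?(mulrBr, scalerBr) //.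
by rewrite qtermZ !qtermM qtermZ !mulrA (mulrC c d).
Qed.

HB.instance Definition _ := GRing.Lalgebra_isAlgebra.Build C A qscalerAr.

Definition qx : A := qterm 1 (0, 1)%N.

Lemma qstarx : qstar qx = qterm 1 (1, 0)%N.
Proof. by rewrite qstarU rmorph1. Qed.

Lemma qx_rel : qx * qstar qx = q%:C *: (qstar qx * qx).
Proof. by rewrite qstarx !qtermM qtermZ /= !mul1r mulr1. Qed.

Lemma qtermE c k : qterm c k = c *: (qstar qx ^+ k.1 * qx ^+ k.2).
Proof.
case: k => m n /=.
have -> : qstar qx ^+ m = qterm 1 (m, 0)%N.
  by elim: m => // m IH; rewrite exprS IH qstarx qtermM /= mul0n expr0 !mulr1.
have -> : qx ^+ n = qterm 1 (0, n)%N.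
  by elim: n => // n IH; rewrite exprS IH qtermM /= muln0 expr0 !mulr1.
by rewrite qtermM qtermZ /= mul0n expr0 !mulr1 addn0.
Qed.

Lemma qbasis_span f : f = \sum_(k <- qsupp f)
  qcoef f k *: (qstar qx ^+ k.1 * qx ^+ k.2).
Proof. by rewrite {1}[f]qterm_sum; apply: eq_bigr => k _; rewrite qtermE. Qed.

Lemma qbasis_free (D : {fset nat * nat}) (a : nat * nat -> C) :
  \sum_(k <- D) a k *: (qstar qx ^+ k.1 * qx ^+ k.2) = 0 ->
  forall k, k \in D -> a k = 0.
Proof.
move=> /(congr1 (@qcoef R q)) + k kD => /(congr1 (@^~ k)).
under eq_bigr do rewrite -qtermE.
rewrite /qcoef (raddf_sum (@monalg.mcoeff _ C k)) /= monalg.mcoeff0.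
rewrite (big_fsetD1 k) //= monalg.mcoeffUU big1_fset ?addr0 // => l.
by rewrite in_fsetD1 monalg.mcoeffU; case: eqP.
Qed.
End QAlgebraTheory.

Record star_axioms (C : numClosedFieldType) (B : algType C) (s : B -> B) : Prop
  := StarAxioms {
  starD : {morph s : u v / u + v};
  starZ : forall (c : C) u, s (c *: u) = Num.conj c *: s u;
  starM : forall u v, s (u * v) = s v * s u;
  starK : involutive s }.

Section QStar.
Context {R : realType} {q : R}.
Local Notation C := R[i].
Local Notation A := (qalg q).

Lemma conj_real (a : R) : Num.conj (a%:C : C) = a%:C.
Proof. by apply: conj_Creal; rewrite realE -[0](rmorph0 (real_complex R)) !lecR; exact: num_real. Qed.

Lemma qstar_axioms : star_axioms (@qstar R q).
Proof.
split.
- exact: sub_add qstarB.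
- move=> c; apply: qalg_ext => [f g|f g|d k]; rewrite ?(scalerBr, qstarB) //.
  by rewrite qtermZ !qstarU qtermZ rmorphM.
- move=> f g; move: f; apply: qalg_ext => [f h|f h|c k];
    rewrite ?(mulrBl, qstarB, mulrBr) //.
  move: g; apply: qalg_ext => [g h|g h|d l];
    rewrite ?(mulrBl, qstarB, mulrBr) //.
  rewrite qtermM !qstarU qtermM /= !rmorphM rmorphXn /= conj_real.
  by rewrite [Num.conj c * _]mulrC mulnC ![(_ + k.1)%N]addnC ![(_ + k.2)%N]addnC.
- apply: qalg_ext => [f g|f g|c k]; rewrite ?qstarB //.
  by rewrite !qstarU /= conjCK -surjective_pairing.
Qed.

Theorem qalg_universal (B : algType C) (s : B -> B) (b : B) :
  star_axioms s -> b * s b = q%:C *: (s b * b) ->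
  exists phi : {lrmorphism A -> B},
    [/\ phi qx = b, {morph phi : f / qstar f >-> s f} &
        forall psi : {lrmorphism A -> B}, psi qx = b ->
          {morph psi : f / qstar f >-> s f} -> psi =1 phi].
Proof.
move=> [sD sZ sM sK] bq.
have com m n : b ^+ n * s b ^+ m = (q%:C) ^+ (n * m) *: (s b ^+ m * b ^+ n).
  have com1 j : b * s b ^+ j = (q%:C) ^+ j *: (s b ^+ j * b).
    elim: j => [|j IH]; first by rewrite mulr1 mul1r scale1r.
    rewrite exprSr mulrA IH -scalerAl -[_ * b * s b]mulrA bq -scalerAr scalerA mulrA.
    by rewrite !exprSr.
  elim: n => [|n IH]; first by rewrite mul1r mulr1 scale1r.
  rewrite exprS -mulrA IH -scalerAr [b * (_ * _)]mulrA com1 -scalerAl scalerA.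
  by rewrite -[_ * b * _]mulrA -exprD mulSn addnC.
pose F (k : nat * nat) (c : C) : B := c *: (s b ^+ k.1 * b ^+ k.2).
have aF : qadditive F by move=> k c d; rewrite /F scalerBl.
pose p : A -> B := qsum F.
have pB : {morph p : f g / f - g} := qsum_additive aF.
have pU c k : p (qterm c k) = c *: (s b ^+ k.1 * b ^+ k.2) := qsumU c k aF.
have pZ : scalable p.
  move=> c; apply: qalg_ext => [f g|f g|d k]; rewrite ?(scalerBr, pB) //.
  by rewrite qtermZ !pU scalerA.
have pM : {morph p : f g / f * g}.
  move=> f g; move: f; apply: qalg_ext => [f h|f h|c k];
    rewrite ?(mulrBl, pB, mulrBr) //.
  move: g; apply: qalg_ext => [g h|g h|d l]; rewrite ?(mulrBl, pB, mulrBr) //.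
  have sc (u v : B) : (c *: u) * (d *: v) = (c * d) *: (u * v).
    by rewrite -scalerAl -scalerAr scalerA.
  rewrite qtermM !pU /= sc -scalerA; congr (_ *: _).
  rewrite !exprD -[RHS]mulrA [b ^+ _ * (_ * _)]mulrA com -scalerAl -scalerAr.
  by rewrite !mulrA.
have p1 : p 1 = 1 by rewrite [p _](pU 1 (0, 0)%N) mulr1 scale1r.
have s1 : s 1 = 1 by have := sM 1 (s 1); rewrite mul1r sK mul1r.
have sX u n : s (u ^+ n) = s u ^+ n.
  by elim: n => [|n IH]; rewrite ?expr0 // exprS sM IH exprSr.
have sB : {morph s : u v / u - v}.
  by move=> u v; rewrite sD -scaleN1r sZ rmorphN1 scaleN1r.
pose m1 := GRing.isZmodMorphism.Build A B p pB.
pose m2 := GRing.isMonoidMorphism.Build A B p (p1, pM).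
pose m3 := GRing.isScalable.Build C A B *:%R p pZ.
pose phi : {lrmorphism A -> B} := HB.pack p m1 m2 m3.
have psis : {morph p : f / qstar f >-> s f}.
  apply: qalg_ext => [f g|f g|c k]; rewrite ?(qstarB, pB, sB) //.
  by rewrite qstarU !pU sZ sM !sX sK.
exists phi; split => [||psi psix psiS] //.
  by rewrite /= pU scale1r mul1r.
apply: qalg_ext => [f g|f g|c k]; rewrite ?raddfB //.
rewrite [RHS]pU qtermE linearZ /= rmorphM !rmorphXn /=.
by rewrite psiS psix.
Qed.
End QStar.

Definition sum_of_squares (R : realType) (q : R) (f : qalg q) : Prop :=
  exists s : seq (qalg q), f = \sum_(a <- s) qstar a * a.

(* A partially defined map; the values of app outside dom are irrelevant. *)
Record operator (H : Type) := Operator { dom : set H; app : H -> H }.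

Definition op_id (H : Type) : operator H := Operator setT id.

Definition op_comp (H : Type) (Y X : operator H) : operator H :=
  Operator [set v | dom X v /\ dom Y (app X v)] (app Y \o app X).

Definition op_pow (H : Type) (X : operator H) (n : nat) : operator H :=
  iter n (op_comp X) (op_id H).

Definition dom_infty (H : Type) (X : operator H) : set H :=
  \bigcap_(n in [set n | (1 <= n)%N]) dom (op_pow X n).

Section HilbertOperators.
Context {R : realType} {H : completeNormedModType R[i]}.
Variable ip : {dot H for Num.conj}.
Implicit Types X : operator H.

(* ip is linear in its first argument; with this compatibility the complete
   normed space H is a Hilbert space. *)
Definition hilbert_inner : Prop := forall v, `|v| ^+ 2 = ip v v.

Definition linear_operator X : Prop :=
  dom X 0 /\ forall (a : R[i]) u v, dom X u -> dom X v ->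
    dom X (a *: u + v) /\ app X (a *: u + v) = a *: app X u + app X v.

Definition densely_defined X : Prop := dense (dom X).

Definition adjoint_at X (v : H) : set H :=
  [set w | forall u, dom X u -> ip (app X u) v = ip u w].

(* For densely defined X the set adjoint_at X v has at most one element. *)
Definition adjoint X : operator H :=
  Operator [set v | adjoint_at X v !=set0] (fun v => xget 0 (adjoint_at X v)).

Definition q_normal (q : R) X : Prop :=
  [/\ linear_operator X, densely_defined X, dom X = dom (adjoint X) &
      forall v, dom X v ->
        `|app (adjoint X) v| = (Num.sqrt q)%:C * `|app X v|].

(* f(X, X^* ) = sum alpha_mn X^*m X^n on the intersection of the domains of its
   terms; for q-normal X this intersection contains dom_infty X. *)
Definition qeval (q : R) (f : qalg q) X : operator H :=
  let XmXn k := op_comp (op_pow (adjoint X) k.1) (op_pow X k.2) in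
  Operator [set v | forall k, k \in qsupp f -> dom (XmXn k) v]
    (fun v => \sum_(k <- qsupp f) qcoef f k *: app (XmXn k) v).
End HilbertOperators.

Definition qpositive (R : realType) (q : R) (f : qalg q) : Prop :=
  qstar f = f /\
  forall (H : completeNormedModType R[i]) (ip : {dot H for Num.conj}),
    hilbert_inner ip ->
  forall X : operator H, q_normal ip q X ->
  forall v, dom_infty X v -> 0 <= ip (app (qeval ip f X) v) v.

Definition qL (R : realType) (q c : R) : qalg q :=
  (qx + qstar qx) ^+ 4 - 2 *: (qx + qstar qx) ^+ 2 + (c%:C)%:A.

(* Main.v *)
Require Import Defs.
From mathcomp Require Import all_boot all_order all_algebra.
From mathcomp Require Import finmap sesquilinear.
From mathcomp Require Import boolp classical_sets reals topology normedtype.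
From mathcomp Require Import complex ring lra zify.
From mathcomp Require monalg.

Set Implicit Arguments.
Unset Strict Implicit.
Unset Printing Implicit Defensive.

Import Order.TTheory GRing.Theory Num.Theory numFieldNormedType.Exports.

Local Open Scope ring_scope.
Local Open Scope complex_scope.

(** Write [N = x^* x] and [k = q (1 + q) / (1 + q^2)], so that the critical constant is
    [k^2 / q].

    Sums of squares.  At the critical constant [L] is a positive combination of
    [b1^* b1] and [b2^* b2] for two explicit elements of degree 2
    ([critical_decomposition]); larger constants only add a multiple of [1].
    Conversely, top coefficients of squares cannot cancel ([top_coef_square]), so a sum
    of squares of degree 4 only involves elements of degree at most 2
    ([square_deg_bound]).  The linear functional [phi] is nonnegative on the squares of
    such elements ([phi_square]) and maps [L_c] to [c] minus the critical constant
    ([phi_qL]).  It is the functional that separates: its kernel, seen as a positive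
    semidefinite form on elements of degree at most 2, contains [b1] and [b2].

    Positivity below the critical constant.  The left ideal generated by [b1] and [b2]
    contains two polynomials in [N] without a common zero on [[0, oo)].  In a
    representation in which [N] has a spectral decomposition, no vector can
    therefore be nearly annihilated by both [b1] and [b2], and this gives a strictly
    positive lower bound for [L].  The quantitative and purely algebraic form of this
    argument is that [S^2 (L - eps) S^2] is a sum of squares, where [S = 1 + N]
    ([lower_bound_mod_denominator]); the passage from the ideal to the bound is a
    Cauchy-Schwarz inequality ([bounded_by_combination]).

    The denominator can be removed in every q-normal operator [X], because
    [1 + X^* X] maps the smooth domain onto itself ([smooth_resolvent]).
    Surjectivity onto the whole space is von Neumann's argument, by projection onto the
    closed graph of [X] ([graph_projection]), and smoothness propagates through the
    relation [X X^* = q X^* X], which follows from the equality of norms defining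
    q-normality ([swap_T'], [swap_T]). *)

(** * Computing in the monomial basis *)

Section Lists.
Context {R : realType} {q : R}.
Local Notation C := R[i].
Local Notation A := (qalg q).
Local Notation key := (nat * nat)%type.

Definition qlist (s : seq (key * C)) : A := \sum_(t <- s) qterm t.2 t.1.

Definition list_mul (s t : seq (key * C)) : seq (key * C) :=
  [seq ((a.1.1 + b.1.1, a.1.2 + b.1.2)%N,
        a.2 * b.2 * q%:C ^+ (a.1.2 * b.1.1)%N) | a <- s, b <- t].

Definition list_star (s : seq (key * C)) : seq (key * C) :=
  [seq ((a.1.2, a.1.1), Num.conj a.2) | a <- s].

Lemma qcoefD (f g : A) k : qcoef (f + g) k = qcoef f k + qcoef g k.
Proof. exact: monalg.mcoeffD. Qed.

Lemma qcoef0 k : qcoef (0 : A) k = 0.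
Proof. exact: monalg.mcoeff0. Qed.

Lemma qcoef_sum I (r : seq I) (P : pred I) (F : I -> A) k :
  qcoef (\sum_(i <- r | P i) F i) k = \sum_(i <- r | P i) qcoef (F i) k.
Proof. exact: (big_morph (fun f => qcoef f k) (fun f g => qcoefD f g k) (qcoef0 k)). Qed.

Lemma qlist_cat s t : qlist s + qlist t = qlist (s ++ t).
Proof. by rewrite /qlist big_cat. Qed.

Lemma qlistZ c s : c *: qlist s = qlist [seq (t.1, c * t.2) | t <- s].
Proof.
by rewrite /qlist scaler_sumr big_map; apply: eq_bigr => t _; rewrite qtermZ.
Qed.

Lemma qlistM s t : qlist s * qlist t = qlist (list_mul s t).
Proof.
rewrite /qlist /list_mul big_allpairs_dep mulr_suml; apply: eq_bigr => a _.
by rewrite mulr_sumr; apply: eq_bigr => b _; rewrite qtermM.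
Qed.

Lemma qlist_star s : qstar (qlist s) = qlist (list_star s).
Proof.
rewrite /qlist /list_star big_map.
rewrite (big_morph _ (sub_add qstarB) (sub_0 qstarB)).
by apply: eq_bigr => a _; rewrite qstarU.
Qed.

Lemma qcoef_qlist s k :
  qcoef (qlist s) k = \sum_(t <- s) (if t.1 == k then t.2 else 0).
Proof. by rewrite qcoef_sum; apply: eq_bigr => t _; rewrite qcoefU; case: eqP. Qed.
End Lists.

Section RealLists.
Context {R : realType}.
Local Notation key := (nat * nat)%type.
Implicit Types s : seq (key * R).

(** The explicit elements of the proof all have real coefficients.  Representing
    them by lists of monomials turns an identity in the algebra into finitely many
    identities between rational functions of [q]. *)
Definition rlist (q : R) s : qalg q := qlist [seq (t.1, t.2%:C) | t <- s].

Definition rmul (q : R) s (t : seq (key * R)) : seq (key * R) :=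
  [seq ((a.1.1 + b.1.1, a.1.2 + b.1.2)%N,
        a.2 * b.2 * q ^+ (a.1.2 * b.1.1)%N) | a <- s, b <- t].

Definition rscale (c : R) s : seq (key * R) := [seq (t.1, c * t.2) | t <- s].

Definition rstar s : seq (key * R) := [seq ((a.1.2, a.1.1), a.2) | a <- s].

(** Transparent equality of exponents, which computes without unfolding structures. *)
Definition key_eq (k l : key) := eqn k.1 l.1 && eqn k.2 l.2.

Definition mono (m n : nat) (c : R) : key * R := ((m, n), c).

Fixpoint rcoef s k : R :=
  if s is t :: s' then
    if key_eq t.1 k then t.2 + rcoef s' k else rcoef s' k
  else 0.

(** Coefficients are compared on an explicit finite list of keys, by conjunctions that
    reduce by computation. *)
Fixpoint agree (ks : seq key) s (t : seq (key * R)) : Prop :=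
  if ks is k :: ks' then rcoef s k = rcoef t k /\ agree ks' s t else True.

Fixpoint insert_key (k : key) (ks : seq key) : seq key :=
  if ks is l :: ks' then if key_eq l k then ks else l :: insert_key k ks'
  else [:: k].

Definition keys s (t : seq (key * R)) : seq key :=
  foldr (fun u ks => insert_key u.1 ks) [::] (s ++ t).

Lemma key_eqE k l : key_eq k l = (k == l).
Proof. by case: k l => [a b] [c d]. Qed.

Lemma mem_insert_key k l ks : k \in insert_key l ks = (k == l) || (k \in ks).
Proof.
elim: ks => //= m ks IH; rewrite key_eqE; case: eqP => [->|_].
  by rewrite inE; case: eqP.
by rewrite !inE IH orbCA.
Qed.

Lemma mem_keys s t k : (k \in keys s t) = (k \in map fst (s ++ t)).
Proof. by rewrite /keys; elim: (s ++ t) => //= u r IH; rewrite mem_insert_key inE IH. Qed.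

Lemma rcoefE s k : rcoef s k = \sum_(t <- s) (if t.1 == k then t.2 else 0).
Proof.
elim: s => [|t s IH]; rewrite ?big_nil ?big_cons //= key_eqE -IH.
by case: eqP; rewrite ?add0r.
Qed.

Lemma rcoef0 s k : k \notin map fst s -> rcoef s k = 0.
Proof.
move=> ks; rewrite rcoefE big_seq big1 // => t ts; case: eqP => // tk.
by move: ks; rewrite -tk map_f.
Qed.

Lemma qcoef_rlist q s k : qcoef (rlist q s) k = (rcoef s k)%:C.
Proof.
rewrite qcoef_qlist big_map rcoefE rmorph_sum; apply: eq_bigr => t _ /=.
by case: eqP.
Qed.

Lemma rlist_eq q s t : agree (keys s t) s t -> rlist q s = rlist q t.
Proof.
move=> st; apply: qcoefP => k; rewrite !qcoef_rlist; congr _%:C.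
have [ks|ks] := boolP (k \in keys s t).
  elim: (keys s t) st ks => //= l r IH [lE rE]; rewrite inE => /predU1P[->//|].
  exact: IH.
by move: ks; rewrite mem_keys map_cat mem_cat negb_or => /andP[? ?]; rewrite !rcoef0.
Qed.

Lemma rlistD q s t : rlist q s + rlist q t = rlist q (s ++ t).
Proof. by rewrite /rlist map_cat qlist_cat. Qed.

Lemma rlistZ q c s : c%:C *: rlist q s = rlist q (rscale c s).
Proof.
rewrite /rlist qlistZ -!map_comp; congr qlist; apply: eq_map => t /=.
by rewrite rmorphM.
Qed.

Lemma rlistN q s : - rlist q s = rlist q (rscale (-1) s).
Proof. by rewrite -scaleN1r -rlistZ rmorphN1. Qed.

Lemma rlistM q s t : rlist q s * rlist q t = rlist q (rmul q s t).
Proof.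
rewrite /rlist qlistM; congr qlist; rewrite /list_mul /rmul.
elim: s => //= a s IH; rewrite map_cat IH -!map_comp; congr (_ ++ _).
by apply: eq_map => b /=; rewrite !rmorphM rmorphXn.
Qed.

Lemma rlist_star q s : qstar (rlist q s) = rlist q (rstar s).
Proof.
rewrite /rlist qlist_star /list_star /rstar -!map_comp; congr qlist.
by apply: eq_map => b /=; rewrite conj_real.
Qed.

Lemma rlist1 q : 1 = rlist q [:: mono 0 0 1].
Proof. by rewrite /rlist /qlist /= big_seq1. Qed.

Lemma rlistX q : qx = rlist q [:: mono 0 1 1].
Proof. by rewrite /rlist /qlist /= big_seq1. Qed.

Lemma rlistA q c : (c%:C)%:A = rlist q [:: mono 0 0 c].
Proof. by rewrite rlist1 rlistZ /rscale /= mulr1. Qed.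
End RealLists.

Ltac rlist_compute :=
  rewrite ?(rlist_star, rlistM, rlistZ, rlistN, rlistD); apply: rlist_eq;
  lazy beta iota zeta delta [mono rmul rstar rscale allpairs flatten map foldr cat
    allpairs_dep keys insert_key key_eq eqn andb agree rcoef fst snd addn addn_rec Nat.add
    muln muln_rec Nat.mul];
  repeat split.



(** * The sum of squares at the critical constant *)

Lemma qLE (R : realType) (q c : R) : qL q c = rlist q [:: mono 0 4 1; mono 4 0 1;
 mono 1 3 (1 + q + q ^+ 2 + q ^+ 3); mono 3 1 (1 + q + q ^+ 2 + q ^+ 3);
 mono 2 2 ((1 + q ^+ 2) * (1 + q + q ^+ 2));
 mono 0 2 (-2); mono 2 0 (-2); mono 1 1 (-2 * (1 + q)); mono 0 0 c].
Proof.
have e2 : (2 : R[i]) = (2 : R)%:C by rewrite rmorph_nat.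
rewrite /qL rlistA e2 !exprS expr0 mulr1 rlistX.
rlist_compute.
all: by ring.
Qed.

Section Cone.
Context {R : realType} {q : R}.
Local Notation C := R[i].
Local Notation A := (qalg q).
Implicit Types (a f g : A) (c : C).

Lemma qstarD : {morph @qstar R q : f g / f + g}.
Proof. exact: (starD qstar_axioms). Qed.

Lemma qstarZ c f : qstar (c *: f) = Num.conj c *: qstar f.
Proof. exact: (starZ qstar_axioms). Qed.

Lemma qstarM f g : qstar (f * g) = qstar g * qstar f.
Proof. exact: (starM qstar_axioms). Qed.

Lemma qstarK : involutive (@qstar R q).
Proof. exact: (starK qstar_axioms). Qed.

Lemma sos_square a : sum_of_squares (qstar a * a).
Proof. by exists [:: a]; rewrite big_seq1. Qed.

Lemma sosD f g : sum_of_squares f -> sum_of_squares g -> sum_of_squares (f + g).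
Proof. by move=> [s ->] [t ->]; exists (s ++ t); rewrite big_cat. Qed.

Lemma sosZ c f : 0 <= c -> sum_of_squares f -> sum_of_squares (c *: f).
Proof.
move=> c0 [s ->]; exists [seq sqrtC c *: a | a <- s].
rewrite big_map scaler_sumr; apply: eq_bigr => a _.
rewrite qstarZ -scalerAl -scalerAr scalerA; congr (_ *: _).
by rewrite mulrC -normCK ger0_norm ?sqrtC_ge0 // sqrtCK.
Qed.

Lemma sos_conj a f : sum_of_squares f -> sum_of_squares (qstar a * f * a).
Proof.
move=> [s ->]; exists [seq b * a | b <- s].
rewrite big_map mulr_sumr mulr_suml; apply: eq_bigr => b _.
by rewrite qstarM !mulrA.
Qed.
End Cone.

Section Factors.
Variables (R : realType) (q : R).
Hypothesis q_gt0 : 0 < q.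

Definition kq : R := q * (q + 1) / (1 + q ^+ 2).
Definition critical : R := q * (q + 1) ^+ 2 / (q ^+ 2 + 1) ^+ 2.

Definition b1 : qalg q :=
  rlist q [:: mono 0 2 q; mono 1 1 (1 + q ^+ 2); mono 2 0 1; mono 0 0 (- kq)].
Definition b2 : qalg q :=
  rlist q [:: mono 0 2 (q ^+ 2); mono 1 1 (1 + q ^+ 2); mono 2 0 q^-1; mono 0 0 (- kq)].

Lemma denominators_neq0 : [/\ q != 0, 1 + q != 0, 1 + q ^+ 2 != 0, q + 1 != 0 & q ^+ 2 + 1 != 0].
Proof.
have q2 : 0 < q ^+ 2 by rewrite exprn_gt0.
by split; apply: lt0r_neq0 => //; rewrite addr_gt0.
Qed.

(** The form [a, b |-> phi (b^* a)] of the functional [phi] below has to vanish at [(a, a)]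
    for every square [a^* a] of a decomposition of the critical [L]; [b1] and [b2] span its kernel
    among the combinations of [1], [x^2], [N], [x^*2]. *)
Lemma critical_decomposition :
  qL q critical = ((q ^+ 2 + q + 1) / (q * (1 + q) ^+ 2))%:C *: (qstar b1 * b1)
          + ((1 + q) ^- 2)%:C *: (qstar b2 * b2).
Proof.
have [n1 n2 n3 n4 n5] := denominators_neq0.
rewrite qLE /b1 /b2 /critical /kq; rlist_compute.
all: by field; rewrite ?n1 ?n2 ?n3 ?n4 ?n5.
Qed.

Lemma sos_above_critical c : critical <= c -> sum_of_squares (qL q c).
Proof.
move=> hc; have -> : qL q c = qL q critical + (c - critical)%:C *: (qstar 1 * 1).
  rewrite !qLE rlist1; rlist_compute; by ring.
rewrite critical_decomposition; do ![apply: sosD | apply: sosZ; last exact: sos_square].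
- by rewrite ler0c divr_ge0 // ltW // ?mulr_gt0 ?exprn_gt0 ?addr_gt0 ?exprn_gt0.
- by rewrite ler0c invr_ge0 exprn_ge0 // addr_ge0 // ltW.
- by rewrite ler0c subr_ge0.
Qed.
End Factors.

(** * Sums of squares below the critical constant *)

Section DegreeBound.
Context {R : realType} {q : R}.
Hypothesis q_gt0 : 0 < q.
Local Notation C := R[i].
Local Notation A := (qalg q).
Implicit Types (a f g : A) (n : nat).

Definition deg_le n a := forall k, (n < k.1 + k.2)%N -> qcoef a k = 0.

Lemma deg_le_exists (s : seq A) : exists n, forall a, a \in s -> deg_le n a.
Proof.
elim: s => [|a s [n IH]]; first by exists 0%N.
pose m := \max_(k <- qsupp a) (k.1 + k.2)%N.
exists (maxn n m) => b; rewrite inE => /predU1P[->|bs] k; rewrite gtn_max => /andP[kn km].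
  apply: monalg.mcoeff_outdom; apply/negP => ks.
  by move: km; rewrite ltnNge => /negP; apply; apply: leq_bigmax_seq.
exact: IH bs k kn.
Qed.

Lemma square_expand a : qstar a * a = \sum_(k <- qsupp a) \sum_(l <- qsupp a)
  qterm (Num.conj (qcoef a k) * qcoef a l * q%:C ^+ (k.1 * l.1))
        (k.2 + l.1, k.1 + l.2)%N.
Proof.
rewrite {1 2}[a]qterm_sum /qsum (big_morph _ (sub_add qstarB) (sub_0 qstarB)) mulr_suml.
apply: eq_bigr => k _; rewrite mulr_sumr; apply: eq_bigr => l _.
by rewrite qstarU qtermM.
Qed.

(** In degree [2n] the coefficient of [x^*n x^n] only sees the products of a
    monomial of degree [n] with its own adjoint, so no cancellation is possible. *)
Lemma top_coef_square a n : deg_le n a ->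
  qcoef (qstar a * a) (n, n) = \sum_(k <- qsupp a)
    (if (k.1 + k.2 == n)%N then `|qcoef a k| ^+ 2 * q%:C ^+ (k.1 * k.1) else 0).
Proof.
move=> da; rewrite square_expand qcoef_sum.
have dk k : k \in qsupp a -> (k.1 + k.2 <= n)%N.
  rewrite leqNgt => ks; apply/negP => /da ak.
  by move: ks; rewrite -monalg.mcoeff_neq0; move/eqP: ak => ->.
rewrite [LHS]big_seq [RHS]big_seq; apply: eq_bigr => k ks.
rewrite qcoef_sum (big_fsetD1 k) //= qcoefU big1_fset ?addr0.
  rewrite xpair_eqE [(k.2 + k.1)%N]addnC andbb.
  by case: eqP => //; rewrite mulr1n [Num.conj _ * _]mulrC -normCK.
move=> l; rewrite in_fsetD1 => /andP[lk ls] _; rewrite qcoefU xpair_eqE.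
case: andP => // -[/eqP e1 /eqP e2]; move: (dk k ks) (dk l ls) => h1 h2.
case/eqP: lk; case: {ks}k {ls}l e1 e2 h1 h2 => [m1 m2] [l1 l2] /= *.
by congr pair; lia.
Qed.

(** A top coefficient is a sum of nonnegative terms over all the squares, so when it
    vanishes every square loses its top degree; descend from any common bound. *)
Lemma square_deg_bound (s : seq A) n :
  (forall m, (n < m)%N -> qcoef (\sum_(a <- s) qstar a * a) (m, m) = 0) ->
  forall a, a \in s -> deg_le n a.
Proof.
move=> tops; have [N] := deg_le_exists s.
elim: N => [|N IH] dN; first by move=> a /dN d k nk; apply: d; apply: leq_ltn_trans nk.
have [Nn|nN] := leqP N.+1 n.
  by move=> a /dN d k nk; apply: d; apply: leq_ltn_trans nk.
apply: IH => a ha k Nk; have [?|Nk'] := ltnP N.+1 (k.1 + k.2)%N; first exact: dN.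
have /eqP kN : (k.1 + k.2)%N == N.+1 by rewrite eqn_leq Nk'.
have := tops N.+1 nN; rewrite qcoef_sum big_seq.
have term_ge0 (b : A) (l : nat * nat) : 0 <= (if (l.1 + l.2 == N.+1)%N then
    `|qcoef b l| ^+ 2 * q%:C ^+ (l.1 * l.1) else 0).
  by case: ifP => // _; rewrite mulr_ge0 ?exprn_ge0 // ler0c ltW.
under eq_bigr => b bs do rewrite (top_coef_square (dN b bs)).
rewrite -big_seq => /eqP; rewrite psumr_eq0; last by move=> b _; apply: sumr_ge0.
move=> /allP /(_ _ ha) /=; rewrite psumr_eq0 // => /allP ks.
apply/eqP; apply: contraTT isT => ak.
have /ks : k \in qsupp a by rewrite -monalg.mcoeff_neq0.
rewrite /= kN eqxx mulf_eq0 expf_eq0 normr_eq0 (negbTE ak) /= expf_eq0.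
by rewrite eq_complex /= (gt_eqF q_gt0) andbF.
Qed.
End DegreeBound.

Section Functional.
Variables (R : realType) (q : R).
Hypotheses (q_gt0 : 0 < q) (q_neq1 : q != 1).
Local Notation C := R[i].

Definition Dq : R := (1 + q ^+ 2) ^+ 2 - q * (1 + q) ^+ 2.

(** This is where [q] differs from [1]: one has [Dq = (q - 1) (q^3 - 1)]. *)
Lemma Dq_gt0 : 0 < Dq.
Proof.
have -> : Dq = (q - 1) ^+ 2 * ((q + 1 / 2) ^+ 2 + 3 / 4) by rewrite /Dq; field.
by rewrite mulr_gt0 // ?exprn_even_gt0 //= ?subr_eq0 // ltr_wpDl ?sqr_ge0 // divr_gt0.
Qed.

Definition m11 : R := kq q / (1 + q ^+ 2).
Definition m22 : R := kq q ^+ 2 / (q * Dq).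
Definition rq : R := q * (1 + q) / (1 + q ^+ 2).

(** The values of [phi] on the monomials.  The form [a, b |-> phi (b^* a)] splits by the
    degree of the monomials modulo 2; [m11] and the ratio [rq] are determined by
    requiring that [b1] and [b2] lie in its kernel, and [m22] by requiring that the even
    part has rank 2. *)
Definition weight (k : nat * nat) : R :=
  match k with
  | (0, 0) => 1
  | (1, 1) => m11
  | (2, 2) => m22
  | (0, 4) | (4, 0) => q ^+ 2 * m22
  | (1, 3) | (3, 1) => - rq * m22
  | _ => 0
  end.

Definition phi : qalg q -> C := qsum (fun k c => (weight k)%:C * c).

Lemma phi_additive : {morph phi : f g / f - g}.
Proof. by apply: qsum_additive => k c d; rewrite mulrBr. Qed.

Lemma phi_qlist s : phi (qlist s) = \sum_(t <- s) (weight t.1)%:C * t.2.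
Proof.
rewrite /qlist (big_morph _ (sub_add phi_additive) (sub_0 phi_additive)).
by apply: eq_bigr => t _; rewrite /phi qsumU // => k c d; rewrite mulrBr.
Qed.

Lemma phi_qL c : phi (qL q c) = (c - critical q)%:C.
Proof.
have [n1 n2 n3 n4 n5] := denominators_neq0 q_gt0; have Dn := lt0r_neq0 Dq_gt0.
rewrite qLE /rlist phi_qlist big_map; under eq_bigr do rewrite -rmorphM.
rewrite -rmorph_sum; congr _%:C.
rewrite /mono !big_cons big_nil /= /critical /m22 /m11 /rq /kq.
move: Dn; rewrite /Dq => Dn; field.
by rewrite ?n1 ?n2 ?n3 ?n4 ?n5 ?Dn.
Qed.

(** With coefficients [a_mn] of [x^*m x^n],
    [phi (a^* a) = |a_00 + m11 a_11|^2 + m22 |a_02 + q^2 a_20 - rq a_11|^2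
      + m11 (|a_01|^2 + q |a_10|^2)]. *)
Lemma phi_square (a : qalg q) : deg_le 2 a -> 0 <= phi (qstar a * a).
Proof.
move=> da; set p := qcoef a.
have -> : a = qlist [:: ((0, 0)%N, p (0, 0)%N); ((0, 1)%N, p (0, 1)%N);
  ((1, 0)%N, p (1, 0)%N); ((0, 2)%N, p (0, 2)%N); ((1, 1)%N, p (1, 1)%N);
  ((2, 0)%N, p (2, 0)%N)].
  apply: qcoefP => -[m n]; rewrite qcoef_qlist !big_cons big_nil /=.
  case: m n => [|[|[|m]]] [|[|[|n]]] /=; rewrite ?(addr0, add0r) //; apply: da => //=; lia.
have [n1 n2 n3 n4 n5] := denominators_neq0 q_gt0; have Dn := lt0r_neq0 Dq_gt0.
have q2_gt0 : 0 < 1 + q ^+ 2 by rewrite addr_gt0 ?exprn_gt0.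
have k_gt0 : 0 < kq q by rewrite divr_gt0 // mulr_gt0 // addr_gt0.
have m11_gt0 : 0 < m11 by rewrite divr_gt0.
have m22_gt0 : 0 < m22 by rewrite divr_gt0 ?exprn_gt0 // mulr_gt0 // Dq_gt0.
(* Equality of the coefficients of [|a_11|^2] on both sides. *)
have rel : q * m22 = m11 ^+ 2 + m22 * rq ^+ 2.
  move: Dn; rewrite /m22 /m11 /rq /kq /Dq => Dn; field.
  by rewrite ?n1 ?n2 ?n3 ?n4 ?n5 ?Dn.
have relC : q%:C * m22%:C = m11%:C ^+ 2 + m22%:C * rq%:C ^+ 2.
  by rewrite -!(rmorphM, rmorphXn, rmorphD) rel.
rewrite qlist_star qlistM phi_qlist.
rewrite /list_mul /list_star /= !big_cons big_nil /=.
set lhs := (X in 0 <= X).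
have -> : lhs =
    `|p (0, 0)%N + m11%:C * p (1, 1)%N| ^+ 2
  + m22%:C * `|p (0, 2)%N + q%:C ^+ 2 * p (2, 0)%N - rq%:C * p (1, 1)%N| ^+ 2
  + m11%:C * (`|p (0, 1)%N| ^+ 2 + q%:C * `|p (1, 0)%N| ^+ 2).
  rewrite {}/lhs !normCK [(q ^+ 2 * m22)%:C]rmorphM [(- rq * m22)%:C]rmorphM.
  rewrite !(rmorphN, rmorphXn, rmorph1) /=.
  have := conj_real m11; have := conj_real rq; have := conj_real q; move: relC.
  move: (m11%:C) (m22%:C) (rq%:C) (q%:C) => t Y r Q tYr cQ cr ct.
  rewrite !(mul0n, muln0, mul1n, muln1) !(rmorphB, rmorphD, rmorphM, rmorph0) /= cQ cr ct.
  by ring: tYr.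
by rewrite !(addr_ge0, mulr_ge0, exprn_ge0) // ler0c ltW.
Qed.
End Functional.

Lemma critical_le_of_sos (R : realType) (q c : R) : 0 < q -> q != 1 ->
  sum_of_squares (qL q c) -> critical q <= c.
Proof.
move=> q0 q1 [s sE]; rewrite -subr_ge0 -ler0c -(phi_qL q0 q1) sE.
have ds : forall a, a \in s -> deg_le 2 a.
  apply: square_deg_bound => // m m2; rewrite -sE qLE qcoef_rlist.
  by case: m m2 => [|[|[|m]]] //; rewrite /= /key_eq /= !andbF.
rewrite (big_morph _ (sub_add (@phi_additive R q)) (sub_0 (@phi_additive R q))).
by rewrite big_seq; apply: sumr_ge0 => a /ds; apply: phi_square.
Qed.

(** * A positive lower bound modulo a denominator *)

Lemma foil (B : pzRingType) (u v a b : B) :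
  (u + v) * (a + b) = (u * a + v * b) + (u * b + v * a).
Proof. by rewrite mulrDl !mulrDr [v * a + _]addrC addrACA. Qed.

Lemma mulr_middle (B : pzRingType) (c' a' a c : B) :
  (c' * a') * (a * c) = c' * (a' * a) * c.
Proof. by rewrite !mulrA. Qed.

Section Domination.
Context {R : realType} {q : R}.
Local Notation A := (qalg q).
Implicit Types (a b e f g : A).

Definition dominated f g := exists2 K : R, 0 < K & sum_of_squares (K%:C *: g - f).

(** The elements [a] with [a^* a] dominated by [g] form a real vector space, which
    turns the inequalities below into linear algebra over [R]. *)
Definition bounded_by g a := dominated (qstar a * a) g.

Lemma dominated_sos f g : sum_of_squares (g - f) -> dominated f g.
Proof. by move=> gf; exists 1; rewrite // scale1r. Qed.

Lemma dominated_trans f g h : dominated f g -> dominated g h -> dominated f h.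
Proof.
move=> [K K0 fg] [L L0 gh]; exists (K * L); first exact: mulr_gt0.
have -> : (K * L)%:C *: h - f = K%:C *: (L%:C *: h - g) + (K%:C *: g - f).
  by rewrite scalerBr scalerA addrA subrK rmorphM.
by apply: sosD => //; apply: sosZ => //; rewrite ler0c ltW.
Qed.

Lemma dominatedD f f' g : dominated f g -> dominated f' g -> dominated (f + f') g.
Proof.
move=> [K K0 fg] [L L0 gh]; exists (K + L); first exact: addr_gt0.
have -> : (K + L)%:C *: g - (f + f') = (K%:C *: g - f) + (L%:C *: g - f').
  by rewrite rmorphD scalerDl opprD addrACA.
exact: sosD.
Qed.

Lemma dominated_scale (c : R) f : 0 < c -> dominated (c%:C *: f) f.
Proof. by move=> c0; exists c => //; rewrite subrr; exists [::]; rewrite big_nil. Qed.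

Lemma dominated_conj a f g :
  dominated f g -> dominated (qstar a * f * a) (qstar a * g * a).
Proof.
move=> [K K0 fg]; exists K => //.
suff -> : K%:C *: (qstar a * g * a) - qstar a * f * a = qstar a * (K%:C *: g - f) * a.
  exact: sos_conj.
by rewrite mulrBr mulrBl -scalerAr -scalerAl.
Qed.

Lemma squareZ (c : R) a : qstar (c%:C *: a) * (c%:C *: a) = (c ^+ 2)%:C *: (qstar a * a).
Proof. by rewrite qstarZ conj_real -scalerAl -scalerAr scalerA -expr2 rmorphXn. Qed.

Lemma qstarN f : qstar (- f) = - qstar f.
Proof. by rewrite -[- f]sub0r qstarB (sub_0 qstarB) sub0r. Qed.

Lemma square_add a b : qstar (a + b) * (a + b) =
  (qstar a * a + qstar b * b) + (qstar a * b + qstar b * a).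
Proof. by rewrite qstarD foil. Qed.

(** Because [2 a^* a + 2 b^* b - (a + b)^* (a + b) = (a - b)^* (a - b)]. *)
Lemma bounded_byD g a b : bounded_by g a -> bounded_by g b -> bounded_by g (a + b).
Proof.
move=> ag bg; pose c2 := (2%:R : R)%:C.
apply: (@dominated_trans _ (c2 *: (qstar a * a + qstar b * b))); last first.
  apply: (dominated_trans (dominated_scale _ _)); first by rewrite ltr0n.
  exact: (dominatedD ag bg).
apply: dominated_sos.
suff -> : c2 *: (qstar a * a + qstar b * b) - qstar (a + b) * (a + b)
    = qstar (a - b) * (a - b) by exact: sos_square.
rewrite /c2 rmorph_nat scaler_nat mulr2n square_add -[a - b]/(a + - b) square_add.
rewrite qstarN mulrNN mulrN mulNr -opprD.
by rewrite [- (_ + (_ + _))]opprD addrA addrK.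
Qed.

Lemma bounded_byZ g (c : R) a : bounded_by g a -> bounded_by g (c%:C *: a).
Proof.
have [->|c0] := eqVneq c 0.
  move=> [K K0 H]; exists K; first exact: K0; rewrite rmorph0 scale0r mulr0 subr0.
  have -> : K%:C *: g = (K%:C *: g - qstar a * a) + qstar a * a by rewrite subrK.
  exact: (sosD H (sos_square a)).
move=> ag; rewrite /bounded_by squareZ; apply: dominated_trans (dominated_scale _ _) ag.
by rewrite exprn_even_gt0.
Qed.

Lemma bounded_by_conj g a b :
  bounded_by g a -> bounded_by (qstar b * g * b) (a * b).
Proof. by rewrite /bounded_by qstarM mulr_middle; exact: dominated_conj. Qed.

Lemma bounded_by_summand (c : R) a f :
  0 < c -> sum_of_squares f -> bounded_by (c%:C *: (qstar a * a) + f) a.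
Proof.
move=> c0 sf; exists c^-1; first by rewrite invr_gt0.
rewrite scalerDr scalerA -rmorphM mulVf ?gt_eqF // scale1r addrC addKr.
by apply: sosZ => //; rewrite ler0c invr_ge0 ltW.
Qed.

End Domination.

Section CauchySchwarzIdentity.
Variables (C : numClosedFieldType) (B : algType C) (s : B -> B).
Hypothesis sA : star_axioms s.

Lemma square_sub_scaled (l : C) (u p : B) : Num.conj l = l ->
  s (u - l *: p) * (u - l *: p) =
  (s u * u + l ^+ 2 *: (s p * p)) - l *: (s u * p + s p * u).
Proof.
move=> lr; have lN : Num.conj (- l) = - l by rewrite rmorphN /= lr.
rewrite -scaleNr (starD sA) (starZ sA) lN foil.
rewrite -!scalerAl -!scalerAr scalerA mulrNN -expr2; congr (_ + _).
by rewrite -scalerDr scaleNr.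
Qed.

(** If [e = a U + b V] is hermitian, then [(e S)^* (e S)] is both
    [(U S^2)^* (a^* e) + (V S^2)^* (b^* e)] and the adjoint of that, so completing
    the two squares bounds it. *)
Lemma combination_identity (a b U V e S : B) (K l : C) :
  Num.conj l = l -> K * l = 1 ->
  s S = S -> s e = e -> e * S = S * e -> e = a * U + b * V ->
  let W := S * S in
  K *: (s W * (s U * U + s V * V) * W) - s (e * S) * (e * S) =
  K *: (s (U * W - l *: (s a * e)) * (U * W - l *: (s a * e))
      + s (V * W - l *: (s b * e)) * (V * W - l *: (s b * e)))
  + l *: (s e * (K *: W - (a * s a + b * s b)) * e).
Proof.
move=> lr Kl Ss es eS eE W; set M := a * s a + b * s b; set G := s W * _ * W.
have sM := starM sA; have sK := starK sA; have sD := starD sA.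
have Ws : s W = W by rewrite /W sM Ss.
have eW : e * W = W * e by rewrite /W mulrA eS -mulrA eS mulrA.
set Z := s (e * S) * (e * S).
have ZE : Z = W * e * e.
  have ee : e * (e * S) = S * (e * e) by rewrite eS mulrA eS -mulrA.
  by rewrite /Z sM Ss es /W -!mulrA ee.
clearbody W.
have ZE2 : Z = e * W * e by rewrite ZE eW.
have ZE3 : Z = e * e * W by rewrite ZE2 -!mulrA eW.
set u := U * W.
set v := V * W.
set p := s a * e.
set r := s b * e.
have GE : G = s u * u + s v * v.
  by rewrite /G /u /v !sM mulrDr mulrDl !mulrA.
have eE' : e = s U * s a + s V * s b by rewrite -[LHS]es {1}eE sD !sM.
have cross1 : s u * p + s v * r = Z.
  by rewrite /u /v /p /r !sM Ws ZE {3}eE' mulrDr mulrDl !mulrA.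
have cross2 : s p * u + s r * v = Z.
  by rewrite /u /v /p /r !sM !sK es ZE3 {4}eE mulrDr mulrDl !mulrA.
have diag : s p * p + s r * r = e * M * e.
  by rewrite /p /r /M !sM !sK es mulrDr mulrDl !mulrA.
rewrite !square_sub_scaled // [X in _ = _ *: X + _]addrACA -opprD -scalerDr.
rewrite [X in _ = _ *: (_ - _ *: X) + _]addrACA cross1 cross2.
rewrite [X in _ = _ *: (X - _) + _]addrACA -GE -scalerDr diag.
rewrite es mulrBr mulrBl -scalerAr -scalerAl -ZE2.
rewrite scalerBr scalerDr scalerBr !scalerA expr2 mulrA Kl mul1r [l * K]mulrC Kl !scale1r.
by rewrite opprD [RHS]addrA [X in X + Z]addrA subrK addrAC addrK.
Qed.
End CauchySchwarzIdentity.

(** A Cauchy-Schwarz inequality in the algebra: the factors [a] and [b] of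
    [e = a U + b V] are absorbed by one copy of [S], and what is left is controlled
    by [U S^2] and [V S^2]. *)
Lemma bounded_by_combination (R : realType) (q : R) (a b U V e S : qalg q) :
  qstar S = S -> qstar e = e -> e * S = S * e -> e = a * U + b * V ->
  bounded_by (S * S) (qstar a) -> bounded_by (S * S) (qstar b) ->
  bounded_by (qstar (S * S) * (qstar U * U + qstar V * V) * (S * S)) (e * S).
Proof.
move=> Ss es eS eE aS bS; have [K K0] := dominatedD aS bS.
rewrite !qstarK => KM; exists K => //.
have Kl : K%:C * (K^-1)%:C = 1 by rewrite -rmorphM mulfV ?gt_eqF.
rewrite (combination_identity (@qstar_axioms R q) (conj_real _) Kl Ss es eS eE).
by apply: sosD; apply: sosZ; rewrite ?ler0c ?invr_ge0 ?ltW //;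
  [apply: sosD; exact: sos_square | exact: sos_conj].
Qed.

Section LowerBound.
Variables (R : realType) (q : R).
Hypotheses (q_gt0 : 0 < q) (q_neq1 : q != 1).
Local Notation k := (kq q).
Local Notation D := (Dq q).
Local Notation A := (qalg q).

Definition Nq : A := rlist q [:: mono 1 1 1].
Definition Sq : A := rlist q [:: mono 0 0 1; mono 1 1 1].

Lemma star_Sq : qstar Sq = Sq.
Proof. by rewrite /Sq; rlist_compute. Qed.

(** For [a] among [x^2], [x^*2] and [N], the square [a^* a] is a multiple of [x^*2 x^2],
    the top term of [S^2]. *)
Lemma bounded_sqr_degree2 (al be ga de : R) : bounded_by (Sq * Sq)
  (rlist q [:: mono 0 2 al; mono 2 0 be; mono 1 1 ga; mono 0 0 de]).
Proof.
have b0 : bounded_by (Sq * Sq) (1 : A).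
  apply: dominated_sos; suff -> : Sq * Sq - qstar 1 * 1 =
      (2 : R)%:C *: (qstar qx * qx) + qstar Nq * Nq.
    by apply: sosD; [apply: sosZ; rewrite ?ler0c|]; rewrite ?ler0n //; exact: sos_square.
  by rewrite /Sq /Nq rlist1 rlistX; rlist_compute; ring.
have bN : bounded_by (Sq * Sq) Nq.
  apply: dominated_sos; suff -> : Sq * Sq - qstar Nq * Nq =
      (2 : R)%:C *: (qstar qx * qx) + qstar 1 * 1.
    by apply: sosD; [apply: sosZ; rewrite ?ler0c|]; rewrite ?ler0n //; exact: sos_square.
  by rewrite /Sq /Nq rlist1 rlistX; rlist_compute; ring.
have bx (c : R) (z : A) : 0 < c -> qstar z * z = c%:C *: (qstar Nq * Nq) -> bounded_by (Sq * Sq) z.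
  by move=> c0 zE; rewrite /bounded_by zE; apply: dominated_trans (dominated_scale _ c0) bN.
have nq := lt0r_neq0 q_gt0.
have bx2 : bounded_by (Sq * Sq) (rlist q [:: mono 0 2 1]).
  apply: (bx q^-1); first by rewrite invr_gt0.
  by rewrite /Nq; rlist_compute; field.
have by2 : bounded_by (Sq * Sq) (rlist q [:: mono 2 0 1]).
  apply: (bx (q ^+ 3)); first by rewrite exprn_gt0.
  by rewrite /Nq; rlist_compute; field.
have -> : rlist q [:: mono 0 2 al; mono 2 0 be; mono 1 1 ga; mono 0 0 de] =
    al%:C *: rlist q [:: mono 0 2 1] + be%:C *: rlist q [:: mono 2 0 1]
    + ga%:C *: Nq + de%:C *: 1.
  by rewrite /Nq rlist1; rlist_compute; ring.
exact: (bounded_byD (bounded_byD (bounded_byD (bounded_byZ al bx2)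
  (bounded_byZ be by2)) (bounded_byZ ga bN)) (bounded_byZ de b0)).
Qed.

Lemma bounded_star_degree2 (al be ga de : R) : bounded_by (Sq * Sq)
  (qstar (rlist q [:: mono 0 2 al; mono 2 0 be; mono 1 1 ga; mono 0 0 de])).
Proof.
set f := qstar _; suff -> : f = rlist q [:: mono 0 2 be; mono 2 0 al; mono 1 1 ga; mono 0 0 de].
  exact: bounded_sqr_degree2.
by rewrite {}/f; rlist_compute; ring.
Qed.

(** [U] and [V] span the same space as [b1] and [b2]; [x^*2] has been eliminated from
    [V], which leaves it with only two homogeneous components. *)
Definition Uq : A := rlist q [:: mono 0 2 (q ^+ 2); mono 2 0 (-1)].
Definition Vq : A :=
  rlist q [:: mono 0 2 (q * (1 + q)); mono 1 1 (1 + q ^+ 2); mono 0 0 (- k)].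

(** Two polynomials in [N] in the left ideal generated by [U] and [V].  For the
    grading in which [x] has degree 1 and [x^*] degree -1, the degree 0 parts of
    [x^*2 V] and of [x^2 U] are multiples of [N^2]; multiples of [U] and [V] cancel
    the other degrees.  The leading coefficients take into account
    [N^2 = q x^*2 x^2]. *)
Definition Pq : A := rlist q [:: mono 2 2 (- D / q);
  mono 1 1 (k * (1 + q ^+ 2) ^+ 2 / q ^+ 2); mono 0 0 (- k ^+ 2)].
Definition Qq : A := rlist q [:: mono 2 2 (- q ^+ 3 * D);
  mono 1 1 (k * (1 + q ^+ 2) ^+ 2); mono 0 0 (- k ^+ 2)].

Definition affine_N (al be : R) : A := rlist q [:: mono 1 1 al; mono 0 0 be].

Definition Gq : A := qstar (Sq * Sq) * (qstar Uq * Uq + qstar Vq * Vq) * (Sq * Sq).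

Lemma Pq_bounded : bounded_by Gq (Pq * Sq).
Proof.
have [n1 n2 n3 n4 n5] := denominators_neq0 q_gt0.
pose a := rlist q [:: mono 0 2 0; mono 2 0 0;
  mono 1 1 ((1 + q) / q * (1 + q ^+ 2) / q ^+ 2); mono 0 0 (- (1 + q) / q * k)].
pose b := rlist q [:: mono 0 2 0; mono 2 0 ((1 + q) / q);
  mono 1 1 (- (1 + q ^+ 2) / q ^+ 2); mono 0 0 k].
apply: (@bounded_by_combination _ _ a b).
- exact: star_Sq.
- by rewrite /Pq; rlist_compute.
- by rewrite /Pq /Sq; rlist_compute; ring.
- by rewrite /Pq /Uq /Vq /a /b /Dq /kq; rlist_compute; field; rewrite ?n1 ?n2 ?n3 ?n4 ?n5.
- exact: bounded_star_degree2.
- exact: bounded_star_degree2.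
Qed.

Lemma Qq_bounded : bounded_by Gq (Qq * Sq).
Proof.
have [n1 n2 n3 n4 n5] := denominators_neq0 q_gt0.
pose a := rlist q [:: mono 0 2 (- (1 + q) ^+ 2); mono 2 0 0; mono 1 1 0; mono 0 0 0].
pose b := rlist q [:: mono 0 2 (q * (1 + q)); mono 2 0 0;
  mono 1 1 (- (1 + q ^+ 2) * q ^+ 2); mono 0 0 k].
apply: (@bounded_by_combination _ _ a b).
- exact: star_Sq.
- by rewrite /Qq; rlist_compute.
- by rewrite /Qq /Sq; rlist_compute; ring.
- by rewrite /Qq /Uq /Vq /a /b /Dq /kq; rlist_compute; field; rewrite ?n1 ?n2 ?n3 ?n4 ?n5.
- exact: bounded_star_degree2.
- exact: bounded_star_degree2.
Qed.

(** The quadratic terms of [q^4 P] and [Q] agree, as do the linear terms of [q^2 P] and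
    [Q]; eliminating them gives the two polynomials below. *)
Lemma E1_bounded : bounded_by Gq (affine_N (1 + q ^+ 2) (- k) * Sq).
Proof.
have [n1 n2 n3 n4 n5] := denominators_neq0 q_gt0.
have nk : k != 0 by rewrite !mulf_neq0 ?invr_neq0.
have nq : q - 1 != 0 by rewrite subr_eq0.
pose c := ((q - 1) * (1 + q) * k * (1 + q ^+ 2))^-1.
have -> : affine_N (1 + q ^+ 2) (- k) * Sq =
    (c * q ^+ 4)%:C *: (Pq * Sq) + (- c)%:C *: (Qq * Sq).
  rewrite /affine_N /Pq /Qq /Sq /c; move: (kq q) nk => kk nk.
  rlist_compute; field; rewrite ?n1 ?n2 ?n3 ?n4 ?n5 ?nk ?nq //.
apply: bounded_byD; apply: bounded_byZ; [exact: Pq_bounded | exact: Qq_bounded].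
Qed.

Lemma E2_bounded (s : R) : s ^+ 2 = D ->
  bounded_by Gq (rlist q [:: mono 2 2 (q * s ^+ 2); mono 0 0 (- k ^+ 2)] * Sq).
Proof.
move=> sD; have [n1 n2 n3 n4 n5] := denominators_neq0 q_gt0.
have nq : q - 1 != 0 by rewrite subr_eq0.
pose c := ((q - 1) * (1 + q))^-1.
have -> : rlist q [:: mono 2 2 (q * s ^+ 2); mono 0 0 (- k ^+ 2)] * Sq =
    (c * q ^+ 2)%:C *: (Pq * Sq) + (- c)%:C *: (Qq * Sq).
  rewrite sD /Pq /Qq /Sq /c; move: (kq q) => kk.
  rlist_compute; field; rewrite ?n1 ?n2 ?n3 ?n4 ?n5 ?nq //.
apply: bounded_byD; apply: bounded_byZ; [exact: Pq_bounded | exact: Qq_bounded].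
Qed.

(** [s^2 N^2 - k^2] is [(s N - k) (s N + k)], and the second factor is bounded below by
    [k] because [N] is nonnegative. *)
Lemma F_bounded (s : R) : 0 <= s -> s ^+ 2 = D -> bounded_by Gq (affine_N s (- k) * Sq).
Proof.
move=> s0 sD; apply: dominated_trans (E2_bounded sD).
have [n1 n2 n3 n4 n5] := denominators_neq0 q_gt0.
have k0 : 0 < k by rewrite divr_gt0 ?mulr_gt0 ?addr_gt0 ?exprn_gt0.
set E := rlist q _; set F := affine_N _ _.
rewrite [qstar (E * _)]qstarM mulr_middle; apply: bounded_by_conj.
have k0' := ltW k0; exists (k ^- 2); first by rewrite invr_gt0 exprn_gt0.
suff -> : (k ^- 2)%:C *: (qstar E * E) - qstar F * F =
   (s ^+ 2 / k ^+ 2)%:C *: (qstar (Nq * F) * (Nq * F))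
   + (2 * s / k)%:C *: (qstar (qx * F) * (qx * F)).
  have h1 : 0 <= s ^+ 2 / k ^+ 2 by rewrite divr_ge0 ?exprn_ge0.
  have h2 : 0 <= 2 * s / k by apply: divr_ge0 => //; rewrite mulr_ge0 ?ler0n.
  by apply: sosD; (apply: sosZ; [by rewrite ler0c | exact: sos_square]).
have nk := lt0r_neq0 k0; rewrite /E /F /Nq /affine_N rlistX; move: (kq q) nk => kk nk.
by rlist_compute; field.
Qed.

(** The zeros [k / (1 + q^2)] and [k / s] of the two affine polynomials in [N] are
    different, so [S = 1 + N] is a linear combination of them. *)
Lemma S2_bounded : bounded_by Gq (Sq * Sq).
Proof.
have D0 := Dq_gt0 q_neq1; have [s s0 sD] : exists2 s : R, 0 <= s & s ^+ 2 = D.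
  by exists (Num.sqrt D); rewrite ?sqrtr_ge0 // sqr_sqrtr // ltW.
have k0 : 0 < k by rewrite divr_gt0 ?mulr_gt0 ?addr_gt0 ?exprn_gt0.
have ns : 1 + q ^+ 2 - s != 0.
  rewrite subr_eq0; apply/eqP => qs; move: sD; rewrite -qs /Dq => /eqP.
  by rewrite eq_sym subr_eq -subr_eq0 opprD addrA subrr sub0r oppr_eq0 mulf_eq0
    expf_eq0 /= !gt_eqF ?addr_gt0.
(* The solution of [s1 (1 + q^2) + s2 s = 1] and [- k (s1 + s2) = 1]. *)
pose s1 := (1 + s / k) / (1 + q ^+ 2 - s); pose s2 := - k^-1 - s1.
have -> : Sq * Sq = s1%:C *: (affine_N (1 + q ^+ 2) (- k) * Sq) + s2%:C *: (affine_N s (- k) * Sq).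
  rewrite /affine_N /Sq {}/s2 {}/s1; have nk := lt0r_neq0 k0.
  move: (kq q) nk => kk nk.
  by rlist_compute; field; rewrite ?nk ?ns.
by apply: bounded_byD; apply: bounded_byZ; [exact: E1_bounded | exact: F_bounded].
Qed.

Lemma UV_bounded :
  dominated (qstar Uq * Uq + qstar Vq * Vq) (qL q (critical q)).
Proof.
have [n1 n2 n3 n4 n5] := denominators_neq0 q_gt0.
have nq : q - 1 != 0 by rewrite subr_eq0.
have a_gt0 : 0 < (q ^+ 2 + q + 1) / (q * (1 + q) ^+ 2).
  by rewrite divr_gt0 ?mulr_gt0 ?exprn_gt0 ?addr_gt0 ?exprn_gt0.
have e_gt0 : 0 < (1 + q) ^- 2 by rewrite invr_gt0 exprn_gt0 ?addr_gt0.
have sosb a (b : A) : 0 < a -> sum_of_squares (a%:C *: (qstar b * b)).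
  by move=> a0; apply: sosZ; [rewrite ler0c ltW | exact: sos_square].
have b1L : bounded_by (qL q (critical q)) (b1 q).
  rewrite (critical_decomposition q_gt0).
  exact: (bounded_by_summand _ a_gt0 (sosb _ _ e_gt0)).
have b2L : bounded_by (qL q (critical q)) (b2 q).
  rewrite (critical_decomposition q_gt0) addrC.
  exact: (bounded_by_summand _ e_gt0 (sosb _ _ a_gt0)).
have UE : Uq = (q / (q - 1))%:C *: b2 q + (- (q / (q - 1)))%:C *: b1 q.
  rewrite /Uq /b1 /b2; move: (kq q) => kk.
  by rlist_compute; field; rewrite ?n1 ?nq.
have UL : bounded_by (qL q (critical q)) Uq.
  by rewrite UE; exact: (bounded_byD (bounded_byZ _ b2L) (bounded_byZ _ b1L)).
have VE : Vq = b1 q + Uq by rewrite /Vq /b1 /Uq; rlist_compute; ring.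
by apply: (dominatedD UL); rewrite VE; exact: (bounded_byD b1L UL).
Qed.

(** [S^2] is bounded by [S^2 (U^* U + V^* V) S^2], hence by [S^2 L S^2]; the inverse of
    the constant is the gain. *)
Lemma lower_bound_mod_denominator : exists2 eps : R, 0 < eps &
  sum_of_squares (qstar (Sq * Sq) * qL q (critical q - eps) * (Sq * Sq)).
Proof.
have [K K0] := dominated_trans S2_bounded (dominated_conj (Sq * Sq) UV_bounded).
move: (Sq * Sq) => W sK; exists K^-1; first by rewrite invr_gt0.
have -> : qL q (critical q - K^-1) = qL q (critical q) - (K^-1)%:C *: 1.
  by rewrite !qLE rlist1; rlist_compute; ring.
have -> : qstar W * (qL q (critical q) - (K^-1)%:C *: 1) * W
    = (K^-1)%:C *: (K%:C *: (qstar W * qL q (critical q) * W) - qstar W * W).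
  rewrite scalerBr scalerA -rmorphM mulVf ?gt_eqF // scale1r.
  by rewrite mulrBr mulrBl -scalerAr -scalerAl mulr1.
by apply: sosZ; rewrite ?ler0c ?invr_ge0 ?ltW.
Qed.
End LowerBound.

(** * Representations by unbounded operators *)

Section SemiInner.
Variables (R : realType).
Local Notation C := R[i].

(** Positive semidefinite sesquilinear forms, kept as a bare property so that it
    applies to the form of a Hilbert space [H] and to that of [H * H] alike. *)
Record semi_inner (E : lmodType C) (B : E -> E -> C) : Prop := SemiInner {
  si_lin : forall a u v w, B (a *: u + v) w = a * B u w + B v w;
  si_herm : forall u v, B u v = Num.conj (B v u);
  si_pos : forall u, 0 <= B u u }.

Variables (E : lmodType C) (B : E -> E -> C).
Hypothesis sB : semi_inner B.

Lemma siDl u v w : B (u + v) w = B u w + B v w.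
Proof. by rewrite -[u in LHS]scale1r (si_lin sB) mul1r. Qed.

Lemma si0l w : B 0 w = 0.
Proof. by apply: (addrI (B 0 w)); rewrite -siDl !addr0. Qed.

Lemma siZl a u w : B (a *: u) w = a * B u w.
Proof. by rewrite -[_ *: u]addr0 (si_lin sB) si0l addr0. Qed.

Lemma siNl u w : B (- u) w = - B u w.
Proof. by rewrite -scaleN1r siZl mulN1r. Qed.

Lemma siBl u v w : B (u - v) w = B u w - B v w.
Proof. by rewrite siDl siNl. Qed.

Lemma siDr u v w : B w (u + v) = B w u + B w v.
Proof. by rewrite !(si_herm sB w) siDl rmorphD. Qed.

Lemma siZr a u w : B w (a *: u) = Num.conj a * B w u.
Proof. by rewrite !(si_herm sB w) siZl rmorphM. Qed.

Lemma siBr u v w : B w (u - v) = B w u - B w v.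
Proof. by rewrite !(si_herm sB w) siBl rmorphB. Qed.

End SemiInner.

Section Representation.
Variables (R : realType) (q : R) (H : lmodType R[i]) (B : H -> H -> R[i]).
Hypothesis sB : semi_inner B.
Local Notation C := R[i].
Variables (K : H -> Prop) (T T' : H -> H).
Hypotheses (K0 : K 0) (Klin : forall (a : C) u v, K u -> K v -> K (a *: u + v)).
Hypotheses (KT : forall v, K v -> K (T v)) (KT' : forall v, K v -> K (T' v)).
Hypothesis Tlin : forall (a : C) u v, K u -> K v -> T (a *: u + v) = a *: T u + T v.
Hypothesis T'lin : forall (a : C) u v, K u -> K v -> T' (a *: u + v) = a *: T' u + T' v.
Hypothesis adj : forall u v, K u -> K v -> B (T u) v = B u (T' v).
Hypothesis rel : forall v, K v -> T (T' v) = q%:C *: T' (T v).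

Definition mono_op (k : nat * nat) (v : H) : H := iter k.1 T' (iter k.2 T v).

Definition rep (f : qalg q) (v : H) : H := qsum (fun k c => c *: mono_op k v) f.

Lemma repB v : {morph rep^~ v : f g / f - g}.
Proof. by apply: qsum_additive => k c d; rewrite scalerBl. Qed.

Lemma repU c k v : rep (qterm c k) v = c *: mono_op k v.
Proof. by apply: qsumU => l d e; rewrite scalerBl. Qed.

Lemma iter_K (S : H -> H) n v : (forall u, K u -> K (S u)) -> K v -> K (iter n S v).
Proof. by move=> KS Kv; elim: n => //= n; exact: KS. Qed.

Lemma iter_lin (S : H -> H) n a u v : (forall u, K u -> K (S u)) ->
  (forall (a : C) u v, K u -> K v -> S (a *: u + v) = a *: S u + S v) ->
  K u -> K v -> iter n S (a *: u + v) = a *: iter n S u + iter n S v.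
Proof.
by move=> KS Slin Ku Kv; elim: n => //= n ->; rewrite Slin //; apply: iter_K.
Qed.

Lemma mono_op_K k v : K v -> K (mono_op k v).
Proof. by move=> Kv; do 2!apply: iter_K => //. Qed.

Lemma mono_op_lin k a u v : K u -> K v ->
  mono_op k (a *: u + v) = a *: mono_op k u + mono_op k v.
Proof. by move=> Ku Kv; rewrite /mono_op !iter_lin //; apply: iter_K. Qed.

Lemma rep_K f v : K v -> K (rep f v).
Proof.
move=> Kv; rewrite /rep /qsum; elim: (X in \sum_(_ <- X) _) => [|k s IH].
  by rewrite big_nil.
by rewrite big_cons; apply: Klin => //; exact: mono_op_K.
Qed.

Lemma rep_lin f a u v : K u -> K v -> rep f (a *: u + v) = a *: rep f u + rep f v.
Proof.
move=> Ku Kv; rewrite /rep /qsum scaler_sumr -big_split; apply: eq_bigr => k _ /=.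
by rewrite mono_op_lin // scalerDr !scalerA mulrC.
Qed.

Lemma rep_sub f u v : K u -> K v -> rep f (u - v) = rep f u - rep f v.
Proof. by move=> Ku Kv; rewrite addrC -scaleN1r rep_lin // scaleN1r addrC. Qed.

Lemma commute_iter m n v : K v ->
  iter n T (iter m T' v) = (q%:C) ^+ (n * m) *: iter m T' (iter n T v).
Proof.
have Z (S : H -> H) : (forall (a : C) u v, K u -> K v -> S (a *: u + v) = a *: S u + S v) ->
    forall a u, K u -> S (a *: u) = a *: S u.
  move=> Sl a u Ku; have S0 : S 0 = 0.
    by have := Sl 1 0 0 K0 K0; rewrite !scale1r addr0 -[X in X = _]addr0 => /addrI.
  by rewrite -[_ *: u]addr0 Sl // S0 addr0.
have com1 j w : K w -> T (iter j T' w) = (q%:C) ^+ j *: iter j T' (T w).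
  move=> Kw; elim: j => [|j IH] /=; first by rewrite scale1r.
  rewrite rel ?IH; last exact: iter_K.
  rewrite (Z _ T'lin); last by apply: iter_K => //; exact: KT.
  by rewrite scalerA -exprS.
move=> Kv; elim: n => [|n IH] /=; first by rewrite scale1r.
rewrite IH (Z _ Tlin); last by do 2!apply: iter_K => //.
by rewrite com1 ?scalerA -?exprD ?mulSn 1?addnC //; apply: iter_K.
Qed.

Lemma repM f g v : K v -> rep (f * g) v = rep f (rep g v).
Proof.
move=> Kv; move: f; apply: qalg_ext => [f h|f h|c k]; rewrite ?mulrBl ?repB //.
move: g; apply: qalg_ext => [g h|g h|d l].
- by rewrite mulrBr repB.
- by rewrite repB rep_sub //; exact: rep_K.
rewrite qtermM !repU [in RHS]/mono_op.
have Z n (S : H -> H) a u : (forall u, K u -> K (S u)) ->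
  (forall (a : C) u v, K u -> K v -> S (a *: u + v) = a *: S u + S v) ->
  K u -> iter n S (a *: u) = a *: iter n S u.
  move=> KS Sl Ku; have S0 : iter n S 0 = 0.
    have := iter_lin n 1 KS Sl K0 K0.
    by rewrite !scale1r addr0 -[X in X = _]addr0 => /addrI.
  by rewrite -[_ *: u]addr0 iter_lin // S0 addr0.
rewrite [iter k.2 T _]Z //; last exact: mono_op_K.
rewrite [iter k.1 T' _]Z //; last by apply: iter_K => //; exact: mono_op_K.
rewrite commute_iter; last exact: iter_K.
rewrite [iter k.1 T' _]Z //; last by do 3!apply: iter_K => //.
by rewrite /mono_op /= !iterD !scalerA !mulrA.
Qed.

Lemma iter_adj n u v : K u -> K v -> B (iter n T u) v = B u (iter n T' v).
Proof.
move=> Ku; elim: n v => //= n IH v Kv.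
by rewrite adj ?IH -?iterSr //; [exact: KT' | exact: iter_K].
Qed.

Lemma rep_star f u v : K u -> K v -> B (rep f u) v = B u (rep (qstar f) v).
Proof.
move=> Ku Kv; move: f; apply: qalg_ext => [f g|f g|c k].
- by rewrite repB (siBl sB).
- by rewrite qstarB repB (siBr sB).
rewrite qstarU !repU (siZl sB) (siZr sB) conjCK /mono_op /=; congr (_ * _).
rewrite (si_herm sB) -iter_adj //; last exact: iter_K.
by rewrite -(si_herm sB) iter_adj //; exact: iter_K.
Qed.

(** Sums of squares act as positive operators on the invariant domain [K]. *)
Lemma rep_sos f v : sum_of_squares f -> K v -> 0 <= B (rep f v) v.
Proof.
move=> [s ->] Kv; elim: s => [|a s IH].
  by rewrite big_nil (sub_0 (repB v)) (si0l sB).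
rewrite big_cons (sub_add (repB v)) (siDl sB) addr_ge0 // repM // rep_star ?qstarK //.
  exact: (si_pos sB).
exact: rep_K.
Qed.
End Representation.

(** * Orthogonal projection *)

Section Projection.
Variables (R : realType) (E : lmodType R[i]) (B : E -> E -> R[i]).
Hypothesis sB : semi_inner B.
Local Notation C := R[i].
Local Notation Re := (@complex.Re R).

Definition modulus (z : C) : R := Re `|z|.

Lemma modulusE z : `|z| = (modulus z)%:C.
Proof. by rewrite /modulus RRe_real // normr_real. Qed.

Lemma modulus_ge0 z : 0 <= modulus z.
Proof. by rewrite -ler0c -modulusE. Qed.

Lemma modulusD z w : modulus (z + w) <= modulus z + modulus w.
Proof. by rewrite -lecR rmorphD /= -!modulusE ler_normD. Qed.

Definition sqn (u : E) : R := Re (B u u).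

Lemma sqnE u : B u u = (sqn u)%:C.
Proof. by rewrite /sqn RRe_real // ger0_real // (si_pos sB). Qed.

Lemma sqn_ge0 u : 0 <= sqn u.
Proof. by rewrite -ler0c -sqnE (si_pos sB). Qed.

Lemma sqnN u : sqn (- u) = sqn u.
Proof. by rewrite /sqn -scaleN1r (siZl sB) (siZr sB) rmorphN1 mulrA mulrNN !mul1r. Qed.

Lemma sqnZ (c : R) u : sqn (c%:C *: u) = c ^+ 2 * sqn u.
Proof.
apply: complexI; rewrite -sqnE (siZl sB) (siZr sB) conj_real sqnE.
by rewrite rmorphM rmorphXn mulrA expr2.
Qed.

Lemma parallelogram u v : sqn (u + v) + sqn (u - v) = 2 * (sqn u + sqn v).
Proof.
apply: complexI; rewrite rmorphM !rmorphD /= -!sqnE !(siDl sB, siDr sB, siNl sB).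
rewrite -scaleN1r !(siZr sB) rmorphN1 rmorph1; ring.
Qed.

Lemma sqnD_le u v : sqn (u + v) <= 2 * (sqn u + sqn v).
Proof. by rewrite -parallelogram lerDl sqn_ge0. Qed.

(** When [u] is within [d] of minimising [sqn] along the complex line [u + C h],
    it is almost orthogonal to [h]; [d = sqn u] gives a form of the
    Cauchy-Schwarz inequality. *)
Lemma almost_orthogonal (d : R) u h :
  (forall t : C, sqn u <= sqn (u + t *: h) + d) ->
  modulus (B u h) ^+ 2 <= d * (sqn h + 1).
Proof.
move=> min; set z := B u h; set Q := sqn h; pose Z := modulus z ^+ 2.
have Q0 : 0 <= Q := sqn_ge0 h.
have zZ : z * Num.conj z = Z%:C.
  by rewrite -normCK modulusE -rmorphXn.
have Z0 : 0 <= Z by rewrite exprn_even_ge0.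
rewrite -/Z; clearbody Z.
have hu : B h u = Num.conj z by rewrite (si_herm sB).
have Q1 : 0 < Q + 1 by rewrite ltr_wpDl.
pose c : R := - (Q + 1)^-1.
have cQ : c * (Q + 1) = -1 by rewrite /c mulNr mulVf // gt_eqF.
have c0 : c <= 0 by rewrite oppr_le0 invr_ge0 ltW.
clearbody c.
have := min (c%:C * z); have -> : sqn (u + (c%:C * z) *: h) = sqn u + 2 * c * Z + c ^+ 2 * Z * Q.
  apply: complexI; rewrite -sqnE !(siDl sB, siDr sB) !(siZl sB, siZr sB).
  rewrite !sqnE hu -/z rmorphM /= conj_real !(rmorphD, rmorphXn, rmorphM) /= -zZ rmorph1 -/Q.
  by ring.
move=> ineq; have cQ' : c * Q = -1 - c by lra.
have gain : 0 <= 2 * c * Z + c ^+ 2 * Z * Q + d by lra.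
have := mulr_ge0 (ltW Q1) gain.
have -> : (Q + 1) * (2 * c * Z + c ^+ 2 * Z * Q + d) = d * (Q + 1) - Z + c * Z by ring: cQ'.
have := mulr_le0_ge0 c0 Z0; lra.
Qed.

Lemma weak_cauchy_schwarz u h : modulus (B u h) ^+ 2 <= sqn u * (sqn h + 1).
Proof. by apply: almost_orthogonal => t; rewrite lerDr sqn_ge0. Qed.

Definition sqn_cauchy (g : nat -> E) := forall e : R, 0 < e -> exists N,
  forall m n, (N <= m)%N -> (N <= n)%N -> sqn (g m - g n) < e.

Definition sqn_limit (g : nat -> E) l := forall e : R, 0 < e -> exists N,
  forall n, (N <= n)%N -> sqn (g n - l) < e.

Lemma small_modulus_eq0 (z : C) : (forall e : R, 0 < e -> modulus z ^+ 2 <= e) -> z = 0.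
Proof.
move=> small; apply/eqP; rewrite -normr_eq0.
have := modulus_ge0 z; rewrite modulusE => z0.
have [->//|z1] := eqVneq (modulus z) 0.
have zp : 0 < modulus z by rewrite lt_def z1.
have := small (modulus z ^+ 2 / 2); rewrite divr_gt0 ?exprn_gt0 //.
by move/(_ isT) => h; have := exprn_gt0 2 zp; lra.
Qed.

Lemma invS_small (e : R) : 0 < e -> exists N, forall n, (N <= n)%N -> n.+1%:R^-1 < e.
Proof.
move=> e0; exists (Num.trunc e^-1) => n Nn.
rewrite invf_plt ?posrE ?ltr0Sn //; apply: lt_le_trans (truncnS_gt _) _.
by rewrite ler_nat.
Qed.

(** The usual proof: the parallelogram law makes a minimising sequence Cauchy. *)
Lemma orthogonal_projection (G : E -> Prop) : G 0 ->
  (forall (a : C) u v, G u -> G v -> G (a *: u + v)) ->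
  (forall g, (forall n, G (g n)) -> sqn_cauchy g ->
     exists l, G l /\ sqn_limit g l) ->
  forall v, exists g, G g /\ forall h, G h -> B (v - g) h = 0.
Proof.
move=> G0 Glin Gcomp v.
pose A := [set r : R | exists2 g, G g & r = sqn (v - g)]%classic.
have A0 : has_inf A.
  split; first by exists (sqn (v - 0)); exists 0.
  by exists 0 => _ [g _ ->]; exact: sqn_ge0.
set m := inf A.
have mle g : G g -> m <= sqn (v - g) by move=> Gg; apply: ge_inf; [case: A0 | exists g].
have /choice[g gP] : forall n : nat, exists g, G g /\ sqn (v - g) < m + n.+1%:R^-1.
  move=> n; have n0 : 0 < n.+1%:R^-1 :> R by rewrite invr_gt0 ltr0Sn.
  by have [_ [g Gg ->] gm] := inf_adherent n0 A0; exists g.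
have Gg n : G (g n) by case: (gP n).
have gm n : sqn (v - g n) < m + n.+1%:R^-1 by case: (gP n).
have [||l [Gl gl]] := Gcomp g => //.
  move=> e e0; have [|N NP] := @invS_small (e / 4); first by rewrite divr_gt0.
  exists N => i j iN jN; have := parallelogram (v - g i) (v - g j).
  have -> : v - g i - (v - g j) = - (g i - g j) by rewrite !opprB addrC addrA subrK.
  have -> : v - g i + (v - g j) = (2 : R)%:C *: (v - (2^-1 : R)%:C *: (g i + g j)).
    rewrite scalerBr scalerA -rmorphM mulfV ?pnatr_eq0 // scale1r rmorph_nat scaler_nat.
    by rewrite mulr2n addrACA -opprD.
  rewrite sqnN sqnZ.
  have Gij : G ((2^-1 : R)%:C *: (g i + g j)).
    rewrite -[_ *: _]addr0; apply: (Glin) => //.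
    by rewrite -[g i]scale1r; exact: Glin.
  have := mle _ Gij; have := gm i; have := gm j; have := NP i iN; have := NP j jN.
  by move: (j.+1%:R^-1) (i.+1%:R^-1) (sqn _) (sqn _) (sqn _) (sqn _) => *; lra.
exists l; split => // h Gh; apply: small_modulus_eq0 => e e0.
have Q1 : 0 < sqn h + 1 by rewrite ltr_wpDl ?sqn_ge0.
have d0 : 0 < e / (4 * (sqn h + 1)) by rewrite divr_gt0 ?mulr_gt0.
have dE : e / (4 * (sqn h + 1)) * (sqn h + 1) = e / 4 by field; rewrite gt_eqF.
have [N NP] := invS_small d0; have [N' N'P] := gl _ d0.
pose n := maxn N N'; have := NP n (leq_maxl _ _); have := N'P n (leq_maxr _ _).
have : modulus (B (v - g n) h) ^+ 2 <= n.+1%:R^-1 * (sqn h + 1).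
  apply: almost_orthogonal => t; have : G (- t *: h + g n) by exact: Glin.
  move=> /mle; have -> : v - (- t *: h + g n) = v - g n + t *: h.
    by rewrite opprD scaleNr opprK addrCA addrC.
  by have := gm n; move: (n.+1%:R^-1) (sqn _) (sqn _) => *; lra.
have := weak_cauchy_schwarz (g n - l) h.
have -> : B (v - l) h = B (v - g n) h + B (g n - l) h.
  by rewrite -(siDl sB) addrA subrK.
move: (B (v - g n) h) (B (g n - l) h) => z1 z2.
have := modulusD z1 z2.
have := modulus_ge0 (z1 + z2); have := modulus_ge0 z1; have := modulus_ge0 z2.
move: (modulus (z1 + z2)) (modulus z1) (modulus z2) => r r1 r2 p2 p1 p rle le2 le1 s2 s1.
have : r ^+ 2 <= (r1 + r2) ^+ 2 by rewrite ler_sqr ?nnegrE ?addr_ge0.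
have := sqr_ge0 (r1 - r2); rewrite sqrrB sqrrD.
have : n.+1%:R^-1 * (sqn h + 1) <= e / 4.
  apply: le_trans (ler_wpM2r (ltW Q1) (ltW s1)) _.
  by rewrite dE.
have : sqn (g n - l) * (sqn h + 1) <= e / 4.
  apply: le_trans (ler_wpM2r (ltW Q1) (ltW s2)) _.
  by rewrite dE.
move: le1 le2; move: (n.+1%:R^-1 * _) (sqn (g n - l) * _) => w1 w2.
clear -p; lra.
Qed.
End Projection.

(** * q-normal operators *)

Section Hilbert.
Variables (R : realType) (H : completeNormedModType R[i]).
Variable ip : {dot H for Num.conj}.
Hypothesis hi : hilbert_inner ip.
Local Notation C := R[i].

Lemma ip_semi : semi_inner ip.
Proof.
split=> [a u v w|u v|u].
- by rewrite linearPl.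
- by rewrite (hermC ip) expr0 mul1r.
- by rewrite -hi exprn_ge0.
Qed.

Lemma sqn_norm v (e : R) : 0 <= e -> (sqn ip v < e ^+ 2) = (`|v| < e%:C).
Proof.
move=> e0; rewrite -ltcR -(sqnE ip_semi) -hi rmorphXn /=.
by rewrite ltr_pXn2r // nnegrE // ler0c.
Qed.

Lemma sqn_eq0 v : sqn ip v = 0 -> v = 0.
Proof.
move=> v0; apply/eqP; rewrite -normr_eq0 -sqrf_eq0 hi.
by rewrite (sqnE ip_semi) v0.
Qed.

Lemma pos_complex_real (e : C) : 0 < e -> exists2 r : R, 0 < r & e = r%:C.
Proof.
move=> e0; have eE : e = (complex.Re e)%:C by rewrite RRe_real // gtr0_real.
by exists (complex.Re e) => //; rewrite -ltcR -eE.
Qed.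

Lemma hilbert_complete g : sqn_cauchy ip g -> exists l, sqn_limit ip g l.
Proof.
move=> gC.
have Fc : cauchy (g @ \oo)%classic.
  apply: cauchy_exP => e /pos_complex_real[r r0 ->]; have [|N NP] := gC (r ^+ 2).
    by rewrite exprn_gt0.
  exists (g N); exists N => // n /= Nn.
  by rewrite -ball_normE /ball_ /= -sqn_norm ?ltW // NP.
have gl : (g n @[n --> \oo] --> lim (g @ \oo))%classic by exact: cauchy_cvg Fc.
move/cvgrPdist_lt: gl => gl.
exists (lim (g @ \oo)%classic) => e e0.
have [|N _ NP] := gl (Num.sqrt e)%:C; first by rewrite ltcR sqrtr_gt0.
exists N => n Nn; have := NP n Nn.
by rewrite /= -sqn_norm ?sqrtr_ge0 // sqr_sqrtr ?ltW // -(sqnN ip_semi) opprB.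
Qed.

(** If [z] is orthogonal to [u], then [u] is at least as far from [z] as [0] is. *)
Lemma dense_orthogonal (D : set H) z :
  dense D -> (forall u, D u -> ip u z = 0) -> z = 0.
Proof.
move=> dD oz; apply/eqP; apply: contraT => z0.
have [||u [zu Du]] := dD (ball z `|z|)^°%classic.
- by exists z; apply: nbhsx_ballx; rewrite normr_gt0.
- exact: open_interior.
move/interior_subset: zu => zu.
have : `|z| ^+ 2 <= `|z - u| ^+ 2.
  have zu0 : ip z u = 0 by rewrite (si_herm ip_semi) oz // rmorph0.
  rewrite !hi !(siBl ip_semi, siBr ip_semi) zu0 (oz _ Du) !subr0 sub0r opprK.
  by rewrite lerDl (si_pos ip_semi).
rewrite ler_pXn2r ?nnegrE // => zle.
by move: zu; rewrite -ball_normE /ball_ /= => /lt_le_trans /(_ zle); rewrite ltxx.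
Qed.
End Hilbert.

Section QNormal.
Variables (R : realType) (H : completeNormedModType R[i]).
Variable ip : {dot H for Num.conj}.
Hypothesis hi : hilbert_inner ip.
Local Notation C := R[i].
Local Notation sI := (ip_semi hi).

Lemma ip_inj (u v : H) : (forall a, ip a u = ip a v) -> u = v.
Proof.
move=> uv; apply/eqP; rewrite -subr_eq0; apply/eqP/(sqn_eq0 hi).
by rewrite /sqn (siBr sI) uv subrr.
Qed.

Lemma ip_limit (g : nat -> H) l a : sqn_limit ip g l ->
  forall e : R, 0 < e -> exists N, forall n, (N <= n)%N -> modulus (ip a (g n - l)) ^+ 2 < e.
Proof.
move=> gl e e0; have Q1 : 0 < sqn ip a + 1 by rewrite ltr_wpDl ?(sqn_ge0 sI).
have [|N NP] := gl (e / (sqn ip a + 1)); first by rewrite divr_gt0.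
exists N => n /NP h.
have -> : modulus (ip a (g n - l)) = modulus (ip (g n - l) a).
  by apply: complexI; rewrite -!modulusE (si_herm sI) norm_conjC.
by apply: le_lt_trans (weak_cauchy_schwarz sI _ _) _; rewrite -ltr_pdivlMr.
Qed.

Lemma limit_pairing (g g' : nat -> H) l l' a b :
  sqn_limit ip g l -> sqn_limit ip g' l' ->
  (forall n, ip a (g n) = ip b (g' n)) -> ip a l = ip b l'.
Proof.
move=> gl gl' gg; apply/eqP; rewrite -subr_eq0; apply/eqP/small_modulus_eq0 => e e0.
have e4 : 0 < e / 4 by rewrite divr_gt0.
have [N NP] := ip_limit a gl e4; have [N' NP'] := ip_limit b gl' e4.
pose n := maxn N N'; have := NP n (leq_maxl _ _); have := NP' n (leq_maxr _ _).
have -> : ip a l - ip b l' = ip b (g' n - l') + - ip a (g n - l).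
  by rewrite !(siBr sI) gg opprB [RHS]addrC addrA subrK.
move: (ip b _) (ip a _) => z1 z2.
have := modulusD z1 (- z2); have -> : modulus (- z2) = modulus z2.
  by apply: complexI; rewrite -!modulusE normrN.
have := modulus_ge0 (z1 - z2); have := modulus_ge0 z1; have := modulus_ge0 z2.
move: (modulus (z1 - z2)) (modulus z1) (modulus z2) => r r1 r2 p2 p1 p rle.
have : r ^+ 2 <= (r1 + r2) ^+ 2 by rewrite ler_sqr ?nnegrE ?addr_ge0.
have := sqr_ge0 (r1 - r2); rewrite sqrrB sqrrD; lra.
Qed.

Lemma limit_unique (g : nat -> H) l l' : sqn_limit ip g l -> sqn_limit ip g l' -> l = l'.
Proof. by move=> gl gl'; apply: ip_inj => a; exact: limit_pairing gl gl' _. Qed.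

Variables (q : R) (X : operator H).
Hypotheses (q_gt0 : 0 < q) (Xq : q_normal ip q X).
Local Notation D := (dom X).
Local Notation T := (app X).
Local Notation T' := (app (adjoint ip X)).
Local Notation Q := (q%:C).

Lemma D0 : D 0. Proof. by case: Xq => -[]. Qed.

Lemma Dlin (a : C) u v : D u -> D v -> D (a *: u + v).
Proof. by case: Xq => -[_ XL] _ _ _ Du Dv; case: (XL a u v Du Dv). Qed.

Lemma Tlin (a : C) u v : D u -> D v -> T (a *: u + v) = a *: T u + T v.
Proof. by case: Xq => -[_ XL] _ _ _ Du Dv; case: (XL a u v Du Dv). Qed.

Lemma DB u v : D u -> D v -> D (u - v).
Proof. by move=> Du Dv; rewrite addrC -scaleN1r; exact: Dlin. Qed.

Lemma TB u v : D u -> D v -> T (u - v) = T u - T v.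
Proof. by move=> Du Dv; rewrite addrC -scaleN1r Tlin // scaleN1r addrC. Qed.

Lemma T0 : T 0 = 0.
Proof. by rewrite -(subrr (0 : H)) TB ?subrr //; exact: D0. Qed.

Lemma DZ (a : C) u : D u -> D (a *: u).
Proof. by move=> Du; rewrite -[_ *: _]addr0; apply: Dlin => //; exact: D0. Qed.

Lemma TZ (a : C) u : D u -> T (a *: u) = a *: T u.
Proof. by move=> Du; rewrite -[_ *: _]addr0 Tlin ?T0 ?addr0 //; exact: D0. Qed.

Lemma adjoint_unique v w w' : adjoint_at ip X v w -> adjoint_at ip X v w' -> w = w'.
Proof.
move=> vw vw'; apply/eqP; rewrite -subr_eq0; apply/eqP.
have [_ dD _ _] := Xq; apply: (dense_orthogonal hi dD) => u Du.
by rewrite (siBr sI) -vw // -vw' // subrr.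
Qed.

Lemma adjointP v w : adjoint_at ip X v w -> D v /\ T' v = w.
Proof.
move=> vw; have [_ _ DE _] := Xq; split; first by rewrite DE; exists w.
by apply: (adjoint_unique _ vw); rewrite /=; apply: xgetPex; exists w.
Qed.

Lemma Tadj u v : D u -> D v -> ip (T u) v = ip u (T' v).
Proof.
move=> Du; have [_ _ DE _] := Xq; rewrite DE => -[w vw].
by have [_ ->] := adjointP vw; exact: vw.
Qed.

Lemma T'adj u v : D u -> D v -> ip (T' u) v = ip u (T v).
Proof. by move=> Du Dv; rewrite (si_herm sI) -Tadj // -(si_herm sI). Qed.

Lemma T'lin (a : C) u v : D u -> D v -> T' (a *: u + v) = a *: T' u + T' v.
Proof.
move=> Du Dv; case: (@adjointP (a *: u + v) (a *: T' u + T' v)) => // w Dw.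
by rewrite !(siDr sI) !(siZr sI) !Tadj.
Qed.

Lemma T'B u v : D u -> D v -> T' (u - v) = T' u - T' v.
Proof. by move=> Du Dv; rewrite addrC -scaleN1r T'lin // scaleN1r addrC. Qed.

Lemma norm_T' v : D v -> ip (T' v) (T' v) = Q * ip (T v) (T v).
Proof.
move=> Dv; have [_ _ _ nX] := Xq.
by rewrite -!hi nX // exprMn -rmorphXn sqr_sqrtr // ltW.
Qed.

(** Polarisation of the defining identity. *)
Lemma ip_T' u v : D u -> D v -> ip (T' u) (T' v) = Q * ip (T u) (T v).
Proof.
move=> Du Dv; have key (a : C) :
    Num.conj a * (ip (T' u) (T' v) - Q * ip (T u) (T v)) +
    a * (ip (T' v) (T' u) - Q * ip (T v) (T u)) = 0.
  have := norm_T' (Dlin a Dv Du); rewrite Tlin // T'lin //.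
  rewrite !(siDl sI, siDr sI) !(siZl sI, siZr sI) !norm_T' // => /eqP.
  by rewrite -subr_eq0 => /eqP <-; ring.
apply/eqP; rewrite -subr_eq0; move: (key 1) (key 'i); rewrite conjCi rmorph1 !mul1r.
move: (_ - Q * ip (T u) (T v)) (_ - Q * ip (T v) (T u)) => d d' h1 h2.
have : 2 * 'i * d = 'i * (d + d') - (- 'i * d + 'i * d') by ring.
rewrite h1 h2 mulr0 subr0 => /eqP; rewrite mulf_eq0 => /orP[|//].
by rewrite mulf_eq0 pnatr_eq0 (negbTE (neq0Ci _)).
Qed.

(** The operator is closed, as the graph norms of [T] and of the closed
    operator [T'] are equivalent. *)
Lemma graph_closed (g : nat -> H) l1 l2 : (forall n, D (g n)) ->
  sqn_limit ip g l1 -> sqn_limit ip (fun n => T (g n)) l2 -> D l1 /\ T l1 = l2.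
Proof.
move=> Dg gl Tl.
have sqnT' u v : D u -> D v -> sqn ip (T' u - T' v) = q * sqn ip (T u - T v).
  move=> Du Dv; apply: complexI; rewrite rmorphM /= -!(sqnE sI) -T'B // -TB //.
  by rewrite norm_T' //; exact: DB.
have [|h T'l] := @hilbert_complete _ _ _ hi (fun n => T' (g n)).
  move=> e e0; have [|N NP] := Tl (e / q / 4); first by rewrite !divr_gt0.
  exists N => m n /NP hm /NP hn; rewrite sqnT' // mulrC -ltr_pdivlMr //.
  have -> : T (g m) - T (g n) = (T (g m) - l2) + - (T (g n) - l2) by rewrite opprB addrA subrK.
  apply: le_lt_trans (sqnD_le sI _ _) _; rewrite (sqnN sI).
  by move: hm hn; move: (e / q) (sqn _ _) (sqn _ _) => *; lra.
have [Dl T'E] : D l1 /\ T' l1 = h.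
  by apply: adjointP => u Du; apply: limit_pairing gl T'l _ => n; rewrite Tadj.
split=> //; apply: limit_unique Tl => e e0.
have [|N NP] := T'l (q * e); first by rewrite mulr_gt0.
exists N => n /NP; rewrite -T'E sqnT' //.
by rewrite ltr_pM2l.
Qed.

Definition graph_form (p r : H * H) : C := ip p.1 r.1 + ip p.2 r.2.

Lemma graph_form_semi : semi_inner graph_form.
Proof.
split=> [a u v w|u v|u].
- by rewrite /graph_form !(si_lin sI) mulrDr addrACA.
- by rewrite /graph_form rmorphD /= -!(si_herm sI).
- by rewrite addr_ge0 // (si_pos sI).
Qed.

Lemma graph_projection (k w : H) : exists2 f, D f &
  forall u, D u -> ip (k - f) u + ip (w - T f) (T u) = 0.
Proof.
pose G (p : H * H) := D p.1 /\ p.2 = T p.1.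
have sG p : sqn graph_form p = sqn ip p.1 + sqn ip p.2.
  by apply: complexI; rewrite rmorphD /= -!(sqnE sI) -(sqnE graph_form_semi).
have [|||p [[Dp pE] po]] := @orthogonal_projection R _ _ graph_form_semi G _ _ _ (k, w).
- by split; [exact: D0 | rewrite T0].
- move=> a u v [Du uE] [Dv vE]; split; first exact: Dlin.
  by rewrite /= uE vE Tlin.
- move=> g Gg gC.
  have [|l1 gl1] := @hilbert_complete _ _ _ hi (fun n => (g n).1).
    move=> e /gC[N NP]; exists N => m n Nm Nn; apply: le_lt_trans (NP m n Nm Nn).
    by rewrite sG lerDl (sqn_ge0 sI).
  have [|l2 gl2] := @hilbert_complete _ _ _ hi (fun n => (g n).2).
    move=> e /gC[N NP]; exists N => m n Nm Nn; apply: le_lt_trans (NP m n Nm Nn).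
    by rewrite sG lerDr (sqn_ge0 sI).
  have [||Dl Tl] := @graph_closed (fun n => (g n).1) l1 l2 _ gl1.
  - by move=> n; case: (Gg n).
  - by move=> e /gl2[N NP]; exists N => n /NP; case: (Gg n) => _ <-.
  exists (l1, l2); split; first by split.
  move=> e e0; have e2 : 0 < e / 2 by rewrite divr_gt0.
  have [N NP] := gl1 _ e2; have [N' NP'] := gl2 _ e2.
  exists (maxn N N') => n; rewrite geq_max => /andP[/NP h1 /NP' h2].
  by rewrite sG /=; move: h1 h2; move: (sqn _ _) (sqn _ _) => *; lra.
exists p.1 => // u Du; rewrite -pE.
by have /(_ (conj Du erefl)) := po (u, T u).
Qed.

(** [X^** = X]: the component of [(k, w)] orthogonal to the graph lies in the graph
    of the bidual and is orthogonal to itself. *)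
Lemma biadjoint k w : (forall g, D g -> ip (T' g) k = ip g w) -> D k /\ T k = w.
Proof.
move=> kw; have [f Df fo] := graph_projection k w.
have [Dg T'g] : D (w - T f) /\ T' (w - T f) = f - k.
  apply: adjointP => u Du; rewrite (si_herm sI) (si_herm sI u).
  congr Num.conj; apply/eqP; rewrite -subr_eq0.
  by rewrite -[f - k]opprB (siNl sI) opprK addrC fo.
have := kw _ Dg; have := T'adj Dg Df; rewrite T'g => e1 e2.
have : ip (f - k) (f - k) + ip (w - T f) (w - T f) = 0.
  by rewrite (siBr sI) [X in _ + X](siBr sI) e1 e2 addrC addrA subrK subrr.
rewrite !(sqnE sI) -rmorphD => /eqP; rewrite -[0](rmorph0 (real_complex R)).
rewrite (inj_eq (@complexI R)) paddr_eq0 ?(sqn_ge0 sI) // => /andP[/eqP /(sqn_eq0 hi) fk /eqP /(sqn_eq0 hi) wf].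
move/eqP: fk; rewrite subr_eq0 => /eqP <-; split=> //.
by move/eqP: wf; rewrite subr_eq0 => /eqP.
Qed.

(** Projecting [(w, 0)] onto the graph of [T] solves [f + T' T f = w]. *)
Lemma solve_resolvent w : exists f, [/\ D f, D (T f) & T' (T f) = w - f].
Proof.
have [f Df fo] := graph_projection w 0; exists f.
have [//|? ?] := @adjointP (T f) (w - f) _; last by split.
move=> u Du; rewrite (si_herm sI) (si_herm sI u); congr Num.conj.
apply/eqP; rewrite eq_sym -subr_eq0; apply/eqP; rewrite -(fo u Du).
by rewrite sub0r (siNl sI).
Qed.

(** Both [swap] lemmas test a vector against all [T' g] or [T u] and use the polarised
    identity; together they give [T T' = q T' T] wherever one side makes sense. *)
Lemma swap_T' f : D f -> D (T f) -> D (T' f) /\ T (T' f) = Q *: T' (T f).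
Proof.
move=> Df DTf; apply: biadjoint => g Dg.
by rewrite (ip_T' Dg Df) (siZr sI) conj_real Tadj.
Qed.

Lemma swap_T h : D h -> D (T' h) -> D (T h) /\ T' (T h) = Q^-1 *: T (T' h).
Proof.
move=> Dh DTh; apply: adjointP => u Du.
have Qn : Q != 0 by rewrite eq_complex /= gt_eqF.
have Qc : Num.conj (Q^-1) = Q^-1 by rewrite fmorphV /= conj_real.
by rewrite (siZr sI) Qc -(T'adj Du DTh) ip_T' // mulKf.
Qed.

Definition smooth v := forall n, D (iter n T v).

Lemma smooth_lin (a : C) u v : smooth u -> smooth v -> smooth (a *: u + v).
Proof.
move=> su sv n.
have -> : iter n T (a *: u + v) = a *: iter n T u + iter n T v.
  by elim: n => //= n ->; rewrite Tlin.
exact: Dlin.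
Qed.

Lemma smooth0 : smooth 0.
Proof.
move=> n; have -> : iter n T 0 = 0; last exact: D0.
by elim: n => //= n ->; exact: T0.
Qed.

Lemma smooth_T v : smooth v -> smooth (T v).
Proof. by move=> sv n; rewrite -iterSr; exact: sv. Qed.

Lemma smooth_T' v : smooth v -> smooth (T' v).
Proof.
move=> sv n; suff [] : D (iter n T (T' v)) /\ iter n T (T' v) = Q ^+ n *: T' (iter n T v) by [].
elim: n => [|n [IH1 IH2]].
  by rewrite scale1r; split => //; case: (swap_T' (sv 0) (sv 1)).
have [D1 E1] := swap_T' (sv n) (sv n.+1).
have [D2 _] := swap_T' (sv n.+1) (sv n.+2).
have E : iter n.+1 T (T' v) = Q ^+ n.+1 *: T' (iter n.+1 T v).
  by rewrite iterS IH2 TZ // E1 scalerA -exprSr.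
by split=> //; rewrite E; exact: DZ.
Qed.

(** The solution of [f + X^* X f = w] is as smooth as [w]: each [T^(n + 1) f] lies in
    the domain of [T'], with [T' T^(n + 1) f] a multiple of [T^n (w - f)]. *)
Lemma smooth_resolvent w : smooth w -> exists2 f, smooth f & f + T' (T f) = w.
Proof.
move=> sw; have [f [Df DTf E]] := solve_resolvent w.
exists f; last by rewrite E addrC subrK.
suff main n : [/\ D (iter n T f), D (iter n.+1 T f) &
    T' (iter n.+1 T f) = Q ^- n *: (iter n T w - iter n T f)].
  by move=> n; case: (main n).
elim: n => [|n [D1 D2 En]]; first by rewrite invr1 scale1r.
have Dwf : D (iter n T w - iter n T f) := DB (sw n) D1.
have DTT' : D (T' (iter n.+1 T f)) by rewrite En; exact: DZ.
have [D3 E3] := swap_T D2 DTT'; split=> //.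
by rewrite E3 En TZ // TB ?scalerA -?invfM -?exprS //; exact: sw.
Qed.

Lemma dom_infty_smooth v : dom_infty X v -> smooth v.
Proof.
have appE n u : app (op_pow X n) u = iter n T u by elim: n => //= n ->.
by move=> sv n; have [_] := sv n.+1 isT; rewrite -/(op_pow X n) appE.
Qed.

Lemma qeval_rep (f : qalg q) v : app (qeval ip f X) v = rep T T' f v.
Proof.
apply: eq_bigr => k _; congr (_ *: _).
have appE (Y : operator H) n u : app (op_pow Y n) u = iter n (app Y) u.
  by elim: n => //= n ->.
by rewrite /= !appE.
Qed.
End QNormal.

(** * Positivity below the critical constant *)

Lemma qL_positive_below (R : realType) (q : R) : 0 < q -> q != 1 ->
  exists eps : R, 0 < eps /\ qpositive (qL q (critical q - eps)).
Proof.
move=> q0 q1; have [eps e0 sL] := lower_bound_mod_denominator q0 q1.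
exists eps; split=> //; split; first by rewrite qLE; rlist_compute.
move=> H ip hi X Xq v /dom_infty_smooth vs; rewrite qeval_rep.
have sI := ip_semi hi; set T := app X; set T' := app (adjoint ip X).
have sT u : smooth X u -> smooth X (T u) := @smooth_T _ _ X u.
have sT' u : smooth X u -> smooth X (T' u) := smooth_T' hi q0 Xq (v := u).
have s0 : smooth X 0 := smooth0 Xq.
have slin a u w : smooth X u -> smooth X w -> smooth X (a *: u + w).
  exact: (smooth_lin Xq).
have Tl (a : R[i]) u w : smooth X u -> smooth X w -> T (a *: u + w) = a *: T u + T w.
  by move=> su sw; apply: (Tlin Xq); [exact: (su 0) | exact: (sw 0)].
have T'l (a : R[i]) u w : smooth X u -> smooth X w -> T' (a *: u + w) = a *: T' u + T' w.
  by move=> su sw; apply: (T'lin hi Xq); [exact: (su 0) | exact: (sw 0)].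
have ad u w : smooth X u -> smooth X w -> ip (T u) w = ip u (T' w).
  by move=> su sw; apply: (Tadj hi Xq); [exact: (su 0) | exact: (sw 0)].
have re u : smooth X u -> T (T' u) = q%:C *: T' (T u).
  by move=> su; case: (swap_T' hi q0 Xq (su 0) (su 1)).
have repS u : rep T T' (Sq q) u = u + T' (T u).
  rewrite /Sq /rlist /qlist big_cons big_seq1 (sub_add (repB T T' u)) !repU.
  by rewrite /mono_op /= !scale1r.
(* [v] is in the range of the denominator [S^2], so [L - eps] can be tested on it. *)
have [u1 su1 u1v] := smooth_resolvent hi q0 Xq vs.
have [u su uu1] := smooth_resolvent hi q0 Xq su1.
have vE : v = rep T T' (Sq q * Sq q) u.
  by rewrite (repM (K := smooth X)) // !repS uu1 u1v.
have := rep_sos sI s0 slin sT sT' Tl T'l ad re sL su.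
have rM := repM s0 slin sT sT' Tl T'l re.
have rS := rep_star sI sT sT' ad.
rewrite (rM _ _ _ su) -vE (rM _ _ _ vs) rS ?qstarK -?vE //.
exact: (rep_K s0 slin sT sT').
Qed.

Theorem theorem2 (R : realType) (q : R) (q_gt0 : 0 < q) (q_neq1 : q != 1) :
  (forall c : R, sum_of_squares (qL q c) <->
     q * (q + 1) ^+ 2 / (q ^+ 2 + 1) ^+ 2 <= c) /\
  (exists eps : R, 0 < eps /\
     qpositive (qL q (q * (q + 1) ^+ 2 / (q ^+ 2 + 1) ^+ 2 - eps))).
Proof.
split=> [c|]; last exact: qL_positive_below.
by split; [exact: critical_le_of_sos | exact: sos_above_critical].
Qed.
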